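(* Let $a<b$ be real numbers, let $f,g\in\mathcal{RI}([a,b],E_e)$, and let $1\le p,q<\infty$ with $\frac1p+\frac1q=1$. Then $$\left|\int_a^b fg\right|\le\left(\int_a^b|f|^p\right)^{1/p}\left(\int_a^b|g|^q\right)^{1/q}.$$
   Context: $E$ is a Dedekind complete Riesz space with weak order unit $e>0$, and $E_e$ is the order ideal of $E$ generated by $e$, i.e. the set of $x\in E$ with $|x|\le\mu e$ for some real $\mu\ge0$. $E_e$ is Dedekind complete and is an Archimedean $f$-algebra with commutative multiplication and multiplicative unit $e$. For $x\in E_e^+$ and real $r>0$, the power $x^r\in E_e^+$ is defined by functional calculus (i.e. pointwise when $E_e$ is represented as a space $C(K)$ with $e$ corresponding to the constant function $1$). A function $f:[a,b]\to F$ ($F$ a Dedekind complete Riesz space) is bounded if there is $M\in F^+$ with $|f(x)|\le M$ for all $x\in[a,b]$. For a partition $\alpha=\{a=\alpha_0<\dots<\alpha_n=b\}$, let $M_i,m_i$ be the supremum and infimum of $f$ on $[\alpha_{i-1},\alpha_i]$, $U(f,\alpha)=\sum_iM_i(\alpha_i-\alpha_{i-1})$, $L(f,\alpha)=\sum_im_i(\alpha_i-\alpha_{i-1})$, $U(f)=\inf_\alpha U(f,\alpha)$, $L(f)=\sup_\alpha L(f,\alpha)$. A bounded $f$ is Riemann integrable if $L(f)=U(f)$, and the common value is $\int_a^bf$. $\mathcal{RI}([a,b],F)$ is the set of Riemann integrable functions $[a,b]\to F$. Products, absolute values and powers of functions are taken pointwise. *)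

(* Defs.v *)
From HB Require Import structures.
From mathcomp Require Import all_boot all_order all_algebra.
From mathcomp Require Import all_classical all_reals all_analysis.

Set Implicit Arguments.
Unset Strict Implicit.
Unset Printing Implicit Defensive.

Import Order.TTheory GRing.Theory Num.Theory.
Import numFieldNormedType.Exports.

Local Open Scope classical_set_scope.
Local Open Scope ring_scope.

(* The lattice operations are part of the mixin because Hierarchy Builder does
   not allow a structure joining [Order.Lattice] with [GRing.Lmodule] to be
   declared after [Num.RealDomain]. *)
HB.mixin Record Lmodule_isRiesz (R : realType) E
    of GRing.Lmodule R E & Num.POrderedZmodule E := {
  riesz_join : E -> E -> E ;
  riesz_meet : E -> E -> E ;
  riesz_leUx : forall x y z : E,
    (riesz_join x y <= z) = (x <= z) && (y <= z) ;
  riesz_lexI : forall x y z : E,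
    (z <= riesz_meet x y) = (z <= x) && (z <= y) ;
  riesz_leD2r : forall z x y : E, x <= y -> x + z <= y + z ;
  riesz_leZ : forall (c : R) (x y : E), 0 <= c -> x <= y -> c *: x <= c *: y
}.

#[short(type="rieszType")]
HB.structure Definition Riesz (R : realType) :=
  { E of GRing.Lmodule R E & Num.POrderedZmodule E & Lmodule_isRiesz R E }.

Section RieszNotions.
Variables (R : realType) (E : rieszType R).

Definition riesz_abs (x : E) : E := riesz_join x (- x).

Definition dedekind_complete : Prop :=
  forall A : set E, A !=set0 -> has_ubound A -> supremums A !=set0.

Definition weak_order_unit (e : E) : Prop :=
  0 < e /\ forall x : E, riesz_meet (riesz_abs x) e = 0 -> x = 0.

Record f_algebra_mul (mul : E -> E -> E) (u : E) : Prop := FAlgebraMul {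
  f_mulA : associative mul ;
  f_mulC : commutative mul ;
  f_mulDl : left_distributive mul +%R ;
  f_mulZl : forall (c : R) (x y : E), mul (c *: x) y = c *: mul x y ;
  f_mul_ge0 : forall x y : E, 0 <= x -> 0 <= y -> 0 <= mul x y ;
  f_mul_disjoint : forall x y z : E,
    riesz_meet x y = 0 -> 0 <= z -> riesz_meet (mul z x) y = 0 ;
  f_mul1 : left_id u mul
}.

(* [Phi] identifies [E] with the space C(K) of all continuous real functions on
   the compact Hausdorff space [K], with [u] corresponding to 1.  Preservation
   of meets follows from linearity and preservation of joins. *)
Record CK_representation (u : E) (K : topologicalType) (Phi : E -> K -> R)
    : Prop := CKRepresentation {
  CK_compact : compact [set: K] ;
  CK_hausdorff : hausdorff_space K ;
  CK_continuous : forall x : E, continuous (Phi x) ;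
  CK_linear : forall (c : R) (x y : E) (k : K),
    Phi (c *: x + y) k = c * Phi x k + Phi y k ;
  CK_join : forall (x y : E) (k : K),
    Phi (riesz_join x y) k = Num.max (Phi x k) (Phi y k) ;
  CK_unit : forall k : K, Phi u k = 1 ;
  CK_inj : injective Phi ;
  CK_surj : forall h : K -> R, continuous h -> exists x : E, Phi x = h
}.

Definition is_riesz_power (u : E) (r : R) (x y : E) : Prop :=
  exists (K : topologicalType) (Phi : E -> K -> R),
    CK_representation u Phi /\ forall k : K, Phi y k = Phi x k `^ r.

(* Only meant for [0 <= x], [0 < r] and [u] an order unit of [E]. *)
Definition riesz_power (u : E) (r : R) (x : E) : E :=
  xget 0 [set y | is_riesz_power u r x y].

End RieszNotions.

Section RieszLemmas.
Variables (R : realType) (E : rieszType R).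
Implicit Types x y z : E.

Lemma riesz_leD x y z t : x <= y -> z <= t -> x + z <= y + t.
Proof.
move=> xy zt; apply: (le_trans (riesz_leD2r z _ _ xy)).
by rewrite ![y + _]addrC; exact: riesz_leD2r.
Qed.

Lemma riesz_leN x y : x <= y -> - y <= - x.
Proof.
move=> /(riesz_leD2r (- x - y)).
by rewrite addrA subrr add0r addrCA subrr addr0.
Qed.

Lemma riesz_abs_leP x y : (riesz_abs x <= y) <-> (x <= y /\ - x <= y).
Proof. by rewrite /riesz_abs riesz_leUx; split => [/andP[]|[-> ->]]. Qed.

Lemma riesz_abs_ge0 x : 0 <= riesz_abs x.
Proof.
have [h1 h2] : x <= riesz_abs x /\ - x <= riesz_abs x by apply/riesz_abs_leP.
have h2' : (0 : R) <= 2^-1 by rewrite invr_ge0.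
have := riesz_leZ _ _ _ h2' (riesz_leD h1 h2).
by rewrite subrr scaler0 scalerDr -scalerDl -[2^-1]div1r -splitr scale1r.
Qed.

End RieszLemmas.

Section OrderIdeal.
Variables (R : realType) (E : rieszType R) (e : E).
Implicit Types x y : E.

Definition order_ideal_pred : {pred E} :=
  [pred x : E | `[< exists2 mu : R, 0 <= mu & riesz_abs x <= mu *: e >]].

Lemma order_idealP x : (x \in order_ideal_pred) <->
  exists2 mu : R, 0 <= mu & riesz_abs x <= mu *: e.
Proof. by split => [/asboolP|] //= h; apply/asboolP. Qed.

Lemma order_ideal_submod_closed : submod_closed order_ideal_pred.
Proof.
split.
  apply/order_idealP; exists 0 => //; rewrite scale0r.
  by apply/riesz_abs_leP; rewrite oppr0.
move=> c x y /order_idealP[m m0 xm] /order_idealP[n n0 /riesz_abs_leP[yn Nyn]].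
apply/order_idealP; exists (`|c| * m + n); first by rewrite addr_ge0 ?mulr_ge0.
have cle u v : u <= v -> `|c| *: u <= `|c| *: v by exact: riesz_leZ.
have [xm1 Nxm] := (riesz_abs_leP _ _).1 xm.
have [cx Ncx] : c *: x <= `|c| *: (m *: e) /\ - (c *: x) <= `|c| *: (m *: e).
  have [c0|c0] := leP 0 c.
    rewrite ger0_norm // in cle *.
    by split; [exact: cle | rewrite -scalerN; exact: cle].
  rewrite ltr0_norm // in cle *; split; last by rewrite -scaleNr; exact: cle.
  by rewrite -[c *: x]opprK -scalerN -scaleNr; exact: cle.
rewrite scalerDl -scalerA; apply/riesz_abs_leP; rewrite opprD.
by split; exact: riesz_leD.
Qed.

Lemma order_ideal_le_add x y (m n : R) :
  riesz_abs x <= m *: e -> riesz_abs y <= n *: e -> x <= (m + n) *: e.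
Proof.
move=> /riesz_abs_leP[xm _] yn; rewrite scalerDl -[leLHS]addr0.
by apply: riesz_leD xm (le_trans (riesz_abs_ge0 y) yn).
Qed.

Lemma riesz_absN x : riesz_abs (- x) = riesz_abs x.
Proof.
by apply/eqP; rewrite eq_le /riesz_abs opprK !riesz_leUx; apply/andP; split;
  rewrite andbC -riesz_leUx.
Qed.

Lemma order_ideal_convex x y z :
  x \in order_ideal_pred -> y \in order_ideal_pred ->
  (forall t, x <= t -> y <= t -> z <= t) ->
  (forall t, t <= x -> t <= y -> t <= z) -> z \in order_ideal_pred.
Proof.
move=> /order_idealP[m m0 xm] /order_idealP[n n0 yn] zle zge.
apply/order_idealP; exists (m + n); first exact: addr_ge0.
apply/riesz_abs_leP; split.
  apply: zle; first exact: order_ideal_le_add xm yn.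
  by rewrite addrC; exact: order_ideal_le_add yn xm.
rewrite -[leRHS]opprK; apply/riesz_leN/zge; rewrite -[leRHS]opprK; apply/riesz_leN.
  by apply: order_ideal_le_add yn; rewrite riesz_absN.
by rewrite addrC; apply: order_ideal_le_add xm; rewrite riesz_absN.
Qed.

Lemma order_ideal_join_closed x y : x \in order_ideal_pred ->
  y \in order_ideal_pred -> riesz_join x y \in order_ideal_pred.
Proof.
move=> xI yI; apply: (order_ideal_convex xI yI) => t.
  by rewrite riesz_leUx => -> ->.
move=> tx _; apply: (le_trans tx).
by have := lexx (riesz_join x y); rewrite riesz_leUx => /andP[].
Qed.

Lemma order_ideal_meet_closed x y : x \in order_ideal_pred ->
  y \in order_ideal_pred -> riesz_meet x y \in order_ideal_pred.
Proof.
move=> xI yI; apply: (order_ideal_convex xI yI) => t.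
  move=> xt _; apply: le_trans xt.
  by have := lexx (riesz_meet x y); rewrite riesz_lexI => /andP[].
by rewrite riesz_lexI => -> ->.
Qed.

HB.instance Definition _ := GRing.isSubmodClosed.Build _ _ order_ideal_pred
  order_ideal_submod_closed.

(* E_e, as a Riesz space in its own right. *)
Record order_ideal := OrderIdeal {
  ideal_val :> E ;
  _ : ideal_val \in order_ideal_pred
}.

HB.instance Definition _ := [isSub of order_ideal for ideal_val].
HB.instance Definition _ := [Choice of order_ideal by <:].
HB.instance Definition _ := [SubChoice_isSubLmodule of order_ideal by <:].
HB.instance Definition _ :=
  Order.SubChoice_isSubPOrder.Build _ E _ ring_display order_ideal.

Definition ideal_join (x y : order_ideal) : order_ideal :=
  OrderIdeal (order_ideal_join_closed (valP x) (valP y)).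
Definition ideal_meet (x y : order_ideal) : order_ideal :=
  OrderIdeal (order_ideal_meet_closed (valP x) (valP y)).

Let ideal_leUx (x y z : order_ideal) :
  (ideal_join x y <= z) = (x <= z) && (y <= z).
Proof. by rewrite -!Order.le_val; exact: riesz_leUx. Qed.
Let ideal_lexI (x y z : order_ideal) :
  (z <= ideal_meet x y) = (z <= x) && (z <= y).
Proof. by rewrite -!Order.le_val; exact: riesz_lexI. Qed.
Let ideal_leD2r (z x y : order_ideal) : x <= y -> x + z <= y + z.
Proof. by rewrite -!Order.le_val; exact: riesz_leD2r. Qed.
Let ideal_leZ (c : R) (x y : order_ideal) :
  0 <= c -> x <= y -> c *: x <= c *: y.
Proof. by rewrite -!Order.le_val; exact: riesz_leZ. Qed.

HB.instance Definition _ := Lmodule_isRiesz.Build R order_ideal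
  ideal_leUx ideal_lexI ideal_leD2r ideal_leZ.

Lemma ideal_unit_subproof : 0 < e -> e \in order_ideal_pred.
Proof.
move=> /ltW e0; apply/order_idealP; exists 1 => //.
rewrite scale1r; apply/riesz_abs_leP; split => //.
by apply: (le_trans _ e0); rewrite -oppr0; exact: riesz_leN.
Qed.

Definition ideal_unit (e_gt0 : 0 < e) : order_ideal :=
  OrderIdeal (ideal_unit_subproof e_gt0).

End OrderIdeal.

Section RiemannIntegral.
Variables (R : realType) (F : rieszType R) (a b : R).
Implicit Types (f : R -> F) (s : seq R).

(* A function on [a, b] is encoded as a function on [R]: the notions below only
   look at its values on [a, b].  As in [itv_partition], the list [s] holds the
   points of a partition of [a, b] other than [a]. *)

Definition order_bounded f : Prop :=
  exists2 M : F, 0 <= M & forall x, x \in `[a, b] -> riesz_abs (f x) <= M.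

Definition upper_sum f s : F := let t := nth b (a :: s) in
  \sum_(0 <= i < size s)
    (t i.+1 - t i) *: supremum 0 (f @` `[t i, t i.+1]).

Definition lower_sum f s : F := let t := nth b (a :: s) in
  \sum_(0 <= i < size s)
    (t i.+1 - t i) *: infimum 0 (f @` `[t i, t i.+1]).

Definition upper_integral f : F :=
  infimum 0 [set upper_sum f s | s in itv_partition a b].

Definition lower_integral f : F :=
  supremum 0 [set lower_sum f s | s in itv_partition a b].

Definition riemann_integrable f : Prop :=
  order_bounded f /\ lower_integral f = upper_integral f.

(* Meaningful for [riemann_integrable] functions only. *)
Definition riemann_integral f : F := upper_integral f.

End RiemannIntegral.

(* Main.v *)
From HB Require Import structures.
Require Import Defs.
From mathcomp Require Import all_boot all_order all_algebra.
From mathcomp Require Import all_classical all_reals all_analysis.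
From mathcomp Require Import ring lra.

(** The inequality is proved pointwise after representing E_e as C(K), where K
    is a compact Hausdorff space.  Suprema in E_e are not pointwise suprema in
    C(K), so the integrals themselves are handled with order-theoretic
    arguments only, and evaluation at a point of K is used for inequalities
    between finitely many elements of E_e.

    The inequality.  For positive reals x and y, the scaled Young inequality
      |f g| <= x y x^(-p) / p |f|^p + x y y^(-q) / q |g|^q
    holds at every point of K, hence in E_e.  The upper integral is monotone
    and sublinear ([upper_integral_lincomb]), so |int f g| is at most the same
    combination of A = int |f|^p and B = int |g|^q.  Evaluate at a point k of K
    and choose x and y slightly above A(k)^(1/p) and B(k)^(1/q): the bound
    becomes x y, and in the limit A(k)^(1/p) B(k)^(1/q) ([optimal_young]).

    Integrability.  Since f and g are bounded, the oscillations of |f|^p and f g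
    on an interval are at most a constant times the oscillations of f and g, and
    a function is integrable when the infimum over partitions of its
    weighted oscillation sums vanishes ([riemann_integrable_oscillation]).

    The representation ([spectrum_representation]).  The points of K are the
    characters, that is, the Riesz homomorphisms from E_e to the reals that map
    the unit u to 1, with the topology of pointwise convergence.  K is compact
    because a pointwise limit of characters along an ultrafilter is a character.
    Enough characters exist by a forcing argument: the positive elements w of
    E_e are regarded as conditions, w decides that x lies below t when the
    positive part of x - t u is disjoint from w, every such question is decided
    on a dense set of conditions, and an ultrafilter containing all dense sets
    yields a character ([ultrafilter_character]).  Every continuous function on
    K comes from E_e by the lattice form of the Stone-Weierstrass theorem
    together with Dedekind completeness.

    Powers.  The power x^r is defined by way of an arbitrary representation.
    It depends on the order only: for p > 1 the function s^p is the supremum of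
    its tangent lines, which makes x^p the supremum of a family of elements
    that can be written without any representation ([CK_power_supremum]); for
    r < 1, x^r is characterized by (x^r)^(1/r) = x.

    Multiplication.  Characters are multiplicative for any f-algebra product
    with unit u, because their kernels are ideals ([f_algebra_character]). *)

Set Implicit Arguments.
Unset Strict Implicit.
Unset Printing Implicit Defensive.

Import Order.TTheory GRing.Theory Num.Theory.
Import numFieldNormedType.Exports.

Local Open Scope classical_set_scope.
Local Open Scope ring_scope.

(** * Elementary facts on Riesz spaces *)

Section RieszBasics.
Variables (R : realType) (E : rieszType R).
Implicit Types x y z w : E.

Lemma riesz_le_joinl x y : x <= riesz_join x y.
Proof. by have := lexx (riesz_join x y); rewrite riesz_leUx => /andP[]. Qed.

Lemma riesz_le_joinr x y : y <= riesz_join x y.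
Proof. by have := lexx (riesz_join x y); rewrite riesz_leUx => /andP[]. Qed.

Lemma riesz_ge_meetl x y : riesz_meet x y <= x.
Proof. by have := lexx (riesz_meet x y); rewrite riesz_lexI => /andP[]. Qed.

Lemma riesz_ge_meetr x y : riesz_meet x y <= y.
Proof. by have := lexx (riesz_meet x y); rewrite riesz_lexI => /andP[]. Qed.

Lemma riesz_leDr x y z : (x + z <= y + z) = (x <= y).
Proof.
apply/idP/idP => [/(riesz_leD2r (- z))|/riesz_leD2r]; last exact.
by rewrite !addrK.
Qed.

Lemma riesz_subr_ge0 x y : (0 <= y - x) = (x <= y).
Proof. by rewrite -(riesz_leDr 0 _ x) add0r subrK. Qed.

Lemma riesz_lerBlDr x y z : (x - z <= y) = (x <= y + z).
Proof. by rewrite -(riesz_leDr (x - z) _ z) subrK. Qed.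

Lemma riesz_leZl (c d : R) x : 0 <= x -> c <= d -> c *: x <= d *: x.
Proof.
move=> x0 cd; rewrite -riesz_subr_ge0 -scalerBl -(scaler0 _ (d - c)).
by apply: riesz_leZ => //; rewrite subr_ge0.
Qed.

Lemma riesz_joinZ (c : R) x y :
  0 < c -> riesz_join (c *: x) (c *: y) = c *: riesz_join x y.
Proof.
move=> c0; have c'0 : 0 < c^-1 by rewrite invr_gt0.
apply/eqP; rewrite eq_le riesz_leUx; apply/andP; split.
  by rewrite !riesz_leZ ?(ltW c0) ?riesz_le_joinl ?riesz_le_joinr.
have le_inv z t : c *: z <= t -> z <= c^-1 *: t.
  move=> /(riesz_leZ _ _ _ (ltW c'0)).
  by rewrite scalerA mulVf ?gt_eqF// scale1r.
have inv_le z t : z <= c^-1 *: t -> c *: z <= t.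
  move=> /(riesz_leZ _ _ _ (ltW c0)).
  by rewrite scalerA divff ?gt_eqF// scale1r.
by apply: inv_le; rewrite riesz_leUx; apply/andP; split; apply: le_inv;
  rewrite (riesz_le_joinl, riesz_le_joinr).
Qed.

Definition riesz_pos x := riesz_join x 0.

Lemma riesz_pos_ge0 x : 0 <= riesz_pos x. Proof. exact: riesz_le_joinr. Qed.

Lemma riesz_le_pos x : x <= riesz_pos x. Proof. exact: riesz_le_joinl. Qed.

Lemma riesz_pos_le x y : 0 <= y -> x <= y -> riesz_pos x <= y.
Proof. by move=> y0 xy; rewrite /riesz_pos riesz_leUx xy. Qed.

(** For positive x and w this is riesz_meet x w = 0; quantifying over the common
    lower bounds makes monotonicity in x and w immediate. *)
Definition riesz_disjoint x w := forall z, 0 <= z -> z <= x -> z <= w -> z = 0.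

Lemma riesz_disjointS x y w w' : x <= y -> w' <= w ->
  riesz_disjoint y w -> riesz_disjoint x w'.
Proof.
move=> xy ww yw z z0 zx zw.
by apply: yw => //; [exact: le_trans xy|exact: le_trans ww].
Qed.

Lemma riesz_disjointD x y w : 0 <= x -> 0 <= y ->
  riesz_disjoint x w -> riesz_disjoint y w -> riesz_disjoint (x + y) w.
Proof.
move=> x0 y0 xw yw z z0 zxy zw.
have zx : riesz_meet z x = 0.
  apply: xw; [by rewrite riesz_lexI z0|exact: riesz_ge_meetr|].
  exact: le_trans (riesz_ge_meetl _ _) zw.
apply: yw => //; rewrite -riesz_subr_ge0 -opprB -oppr0; apply: riesz_leN.
rewrite -zx riesz_lexI !riesz_lerBlDr zxy andbT.
by rewrite -{1}[z]addr0 ![z + _]addrC riesz_leDr.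
Qed.

Lemma riesz_disjointZ (c : R) x w : 0 < c -> 0 <= w ->
  riesz_disjoint x w -> riesz_disjoint (c *: x) w.
Proof.
move=> c0 w0 xw z z0 zcx zw.
have d0 : 0 < Num.min c^-1 1 by rewrite lt_min invr_gt0 c0 ltr01.
have /eqP : Num.min c^-1 1 *: z = 0.
  apply: xw.
  - by rewrite -(scaler0 _ (Num.min c^-1 1)); apply: riesz_leZ (ltW d0) z0.
  - apply: le_trans (_ : c^-1 *: z <= _).
      by apply: riesz_leZl => //; rewrite ge_min lexx.
    rewrite -[leRHS](scale1r) -(mulVf (lt0r_neq0 c0)) -scalerA.
    by apply: riesz_leZ zcx; rewrite invr_ge0 ltW.
  - apply: le_trans zw; rewrite -[leRHS]scale1r.
    by apply: riesz_leZl => //; rewrite ge_min lexx orbT.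
by rewrite scaler_eq0 gt_eqF//= => /eqP.
Qed.

(** A common lower bound z of the positive parts of x and - x satisfies
    x^+ <= x^+ - z, since x^+ - z dominates both 0 and x. *)
Lemma riesz_disjoint_posN x : riesz_disjoint (riesz_pos x) (riesz_pos (- x)).
Proof.
move=> z z0 zx; rewrite /riesz_pos => zNx; apply/eqP; rewrite eq_le z0 andbT.
have posE : riesz_pos (- x) <= riesz_pos x - x.
  apply: riesz_pos_le; first by rewrite riesz_subr_ge0 riesz_le_pos.
  by rewrite -riesz_subr_ge0 opprK subrK riesz_pos_ge0.
have : riesz_pos x <= riesz_pos x - z.
  apply: riesz_pos_le; first by rewrite riesz_subr_ge0.
  have := le_trans zNx posE; rewrite -riesz_subr_ge0 => zx'.
  by rewrite -riesz_subr_ge0 addrAC.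
by rewrite -[leLHS]addr0 ![riesz_pos x + _]addrC riesz_leDr => /riesz_leN;
  rewrite opprK oppr0.
Qed.

(** If s is the supremum of the multiples of x, then s - x is again an upper
    bound of them. *)
Lemma dedekind_archimedean x y : dedekind_complete E ->
  (forall n : nat, n%:R *: x <= y) -> x <= 0.
Proof.
move=> Ec xy.
have [||s [us ls]] := Ec [set n%:R *: x | n in [set: nat]].
- by exists (0%:R *: x), 0%N.
- by exists y => _ [n _ <-]; exact: xy.
have : s <= s - x.
  apply: ls => _ [n _ <-].
  rewrite -(riesz_leDr _ _ x) subrK -{2}[x]scale1r -scalerDl natr1.
  by apply: us; exists n.+1.
by move=> /(riesz_leD2r (x - s)); rewrite addrCA subrr addr0 addrA subrK subrr.
Qed.

End RieszBasics.

(** * Existence of characters *)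

Section Characters.
Variables (R : realType) (E : rieszType R) (u : E).
Implicit Types x y z w : E.

Definition order_unit := forall x, exists2 m : R, 0 <= m & riesz_abs x <= m *: u.

Record is_character (phi : E -> R) : Prop := IsCharacter {
  character_linear : forall (c : R) x y, phi (c *: x + y) = c * phi x + phi y ;
  character_join : forall x y, phi (riesz_join x y) = Num.max (phi x) (phi y) ;
  character_unit : phi u = 1
}.

(** On the support of w, the element x lies below t u. *)
Definition below_on w x (t : R) := riesz_disjoint (riesz_pos (x - t *: u)) w.

(** The sets containing an open dense set of conditions below w0, where the
    conditions are the strictly positive elements and smaller elements are
    stronger conditions. *)
Definition dense_below w0 : set_system E := [set A : set E |
  forall w, 0 < w -> w <= w0 -> exists2 w', 0 < w' <= w &
    forall v, 0 < v -> v <= w' -> A v].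

Lemma dense_below_proper w0 : 0 < w0 -> ProperFilter (dense_below w0).
Proof.
move=> w00; apply: Build_ProperFilter_ex => [A /(_ w0 w00 (lexx _))[w /andP[w0' _] Aw]|].
  by exists w; exact: Aw.
split=> [w w0' ww0|A B dA dB w w_gt0 ww0|A B AB dA w w_gt0 ww0].
- by exists w; rewrite // w0' lexx.
- have [v /andP[v0 vw] Av] := dA w w_gt0 ww0.
  have [v' /andP[v'0 v'v] Bv'] := dB v v0 (le_trans vw ww0).
  exists v'; first by rewrite v'0 (le_trans v'v).
  by move=> z z0 zv'; split; [exact: Av (le_trans zv' v'v)|exact: Bv'].
- by have [v vw Av] := dA w w_gt0 ww0; exists v => // z z0 zv; exact/AB/Av.
Qed.

(** Every condition w has a stronger one that decides on which side of t the
    element x lies: if w itself does not put x below t, then some nonzero z <= w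
    lies under (x - t u)^+, and z is disjoint from (x - t u)^-. *)
Lemma below_on_dense w0 x t :
  dense_below w0 [set w | below_on w x t \/ below_on w (- x) (- t)].
Proof.
move=> w w_gt0 ww0; have [xw|] := pselect (below_on w x t).
  exists w; first by rewrite w_gt0 lexx.
  by move=> v _ vw; left; exact: riesz_disjointS vw xw.
move=> /existsNP[z /not_implyP[z0 /not_implyP[zx /not_implyP[zw /eqP zN0]]]].
exists z; first by rewrite lt_neqAle eq_sym zN0 z0 zw.
move=> v v0 vz; right=> y y0 yx yv.
apply: (@riesz_disjoint_posN _ _ (x - t *: u)) => //.
  exact: le_trans (le_trans yv vz) zx.
by rewrite opprB addrC; rewrite scaleNr opprK in yx.
Qed.

Hypothesis u_ge0 : 0 <= u.
Hypothesis uP : order_unit.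

(** This is where w must be nonzero: if t < - m, then (x - t u)^+ dominates a
    positive multiple of u, and nothing but 0 is disjoint from u. *)
Lemma below_on_ge w x t m : 0 < w ->
  riesz_abs x <= m *: u -> below_on w x t -> - m <= t.
Proof.
move=> w0 /riesz_abs_leP[_ xm] xt; rewrite leNgt; apply/negP => tm.
have s0 : 0 < - m - t by rewrite subr_gt0.
have [n n0 /riesz_abs_leP[wn _]] := uP w.
have uw : riesz_disjoint ((- m - t) *: u) w.
  apply: riesz_disjointS (lexx _) xt; apply: le_trans (riesz_le_pos _).
  by rewrite scalerBl riesz_leDr scaleNr -[leRHS]opprK; apply: riesz_leN.
have : riesz_disjoint (n *: u) w.
  move: n0; rewrite le_eqVlt => /predU1P[<-|n0].
    by rewrite scale0r => z z0 z0' _; apply/eqP; rewrite eq_le z0' z0.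
  have -> : n *: u = (n / (- m - t)) *: ((- m - t) *: u).
    by rewrite scalerA divfK ?gt_eqF.
  by apply: riesz_disjointZ (ltW w0) uw; rewrite divr_gt0.
by move/(_ w (ltW w0) wn (lexx _)) => w_eq0; rewrite w_eq0 ltxx in w0.
Qed.

Lemma below_on_bound w x m : riesz_abs x <= m *: u -> below_on w x m.
Proof.
move=> /riesz_abs_leP[xm _] z z0 zx _; apply/eqP; rewrite eq_le z0 andbT.
apply: le_trans zx _; apply: riesz_pos_le => //.
by rewrite riesz_lerBlDr add0r.
Qed.

Lemma below_onW w x s t : s <= t -> below_on w x s -> below_on w x t.
Proof.
move=> st; apply: riesz_disjointS (lexx _).
apply: riesz_pos_le (riesz_pos_ge0 _) _; apply: le_trans (riesz_le_pos _).
rewrite ![x + _]addrC; apply: riesz_leD2r; apply: riesz_leN; exact: riesz_leZl.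
Qed.

Lemma below_onD w x y s t :
  below_on w x s -> below_on w y t -> below_on w (x + y) (s + t).
Proof.
move=> xs yt; apply: riesz_disjointS (lexx w) _; last first.
  exact: riesz_disjointD (riesz_pos_ge0 _) (riesz_pos_ge0 _) xs yt.
apply: riesz_pos_le.
  by rewrite -[0]addr0; apply: riesz_leD; exact: riesz_pos_ge0.
by rewrite scalerDl opprD addrACA; apply: riesz_leD; exact: riesz_le_pos.
Qed.

Lemma below_on_join w x y t :
  below_on w x t -> below_on w y t -> below_on w (riesz_join x y) t.
Proof.
move=> xt yt; apply: riesz_disjointS (lexx w) _; last first.
  exact: riesz_disjointD (riesz_pos_ge0 _) (riesz_pos_ge0 _) xt yt.
have le2 (a b : E) : 0 <= a -> b <= b + a.
  by move=> a0; rewrite -{1}[b]addr0 ![b + _]addrC riesz_leDr.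
apply: riesz_pos_le.
  by rewrite -[0]addr0; apply: riesz_leD; exact: riesz_pos_ge0.
rewrite riesz_lerBlDr riesz_leUx; apply/andP; split; rewrite -riesz_lerBlDr.
  by apply: (le_trans (riesz_le_pos _)); exact/le2/riesz_pos_ge0.
apply: (le_trans (riesz_le_pos _)).
by rewrite [leRHS]addrC; exact/le2/riesz_pos_ge0.
Qed.

Lemma below_onZ w x t (c : R) : 0 < c -> 0 <= w ->
  below_on w x t -> below_on w (c *: x) (c * t).
Proof.
move=> c0 w0 xt; rewrite /below_on /riesz_pos -scalerA -scalerBr.
by rewrite -(scaler0 _ c) riesz_joinZ//; exact: riesz_disjointZ.
Qed.

Lemma below_on_unit w t : 0 < w -> below_on w u t -> 1 <= t.
Proof.
move=> w0 ut; suff : - 0 <= t - 1 by rewrite oppr0 subr_ge0.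
apply: (@below_on_ge w 0 _ _ w0).
  by rewrite scale0r; apply/riesz_abs_leP; rewrite oppr0.
by rewrite /below_on scalerBl scale1r opprB addrA add0r.
Qed.

Lemma below_on_unit1 w : below_on w u 1.
Proof.
apply: below_on_bound; rewrite scale1r; apply/riesz_abs_leP; split => //.
by apply: (le_trans _ u_ge0); rewrite -oppr0; exact: riesz_leN.
Qed.

(** An ultrafilter containing all dense sets decides, for each x and t, whether
    x lies below t.  The resulting cut is a sublinear and join-preserving
    functional of x; it is linear because one of the alternatives of
    [below_on_dense] always belongs to the ultrafilter. *)
Section UltrafilterCharacter.
Variables (w0 : E) (G : set_system E).
Hypotheses (GU : UltraFilter G) (w0G : dense_below w0 `<=` G).

Let levels x : set R := [set t | G [set w | below_on w x t]].
Let phi x : R := inf (levels x).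

Let G_gt0 : G [set w | 0 < w].
Proof. by apply: w0G => w w_gt0 ww0; exists w; rewrite // w_gt0 lexx. Qed.

Let levels_lb x m : riesz_abs x <= m *: u -> lbound (levels x) (- m).
Proof.
move=> xm t Gt; have [w [/= w1 xt]] := filter_ex (filterI G_gt0 Gt).
exact: below_on_ge xm xt.
Qed.

Let levels_has_inf x : has_inf (levels x).
Proof.
have [m m0 xm] := uP x; split; last by exists (- m); exact: levels_lb.
by exists m; apply: filterS filterT => w _; exact: below_on_bound.
Qed.

Let phi_le x t : levels x t -> phi x <= t.
Proof. by move=> xt; apply: ge_inf xt; exact: (levels_has_inf x).2. Qed.

Let phi_lt x t : phi x < t -> levels x t.
Proof.
move=> /(inf_lt (levels_has_inf x).1)[s Gs st].
by apply: filterS Gs => w; apply: below_onW; exact: ltW.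
Qed.

Let phiD_le x y : phi (x + y) <= phi x + phi y.
Proof.
apply/ler_addgt0Pr => d d0; have d20 : 0 < d / 2 by lra.
have /phi_lt Gx : phi x < phi x + d / 2 by lra.
have /phi_lt Gy : phi y < phi y + d / 2 by lra.
have -> : phi x + phi y + d = (phi x + d / 2) + (phi y + d / 2) by lra.
apply: phi_le; apply: filterS (filterI Gx Gy) => w [/= xw yw].
exact: below_onD.
Qed.

Let phiN_le x : phi (- x) <= - phi x.
Proof.
apply/ler_addgt0Pr => d d0.
have -> : - phi x + d = - (phi x - d) by lra.
set t := phi x - d; apply: phi_le.
have [Gx|Gx] := in_ultra_setVsetC [set w | below_on w x t] GU.
  have : phi x <= t by exact: phi_le.
  by rewrite /t; lra.
have Gd := w0G (@below_on_dense w0 x t).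
by apply: filterS (filterI Gx Gd) => w [/= ? []].
Qed.

Let phi0 : phi 0 = 0.
Proof.
have p0 : phi 0 <= 0.
  apply: phi_le; apply: filterS filterT => w _; apply: below_on_bound.
  by rewrite scale0r; apply/riesz_abs_leP; rewrite oppr0.
by have := phiD_le 0 0; rewrite addr0 => ?; lra.
Qed.

Let phiN x : phi (- x) = - phi x.
Proof.
by have := phiN_le x; have := phiD_le x (- x); rewrite subrr phi0 => ? ?; lra.
Qed.

Let phiD x y : phi (x + y) = phi x + phi y.
Proof.
have := phiD_le (x + y) (- y); rewrite addrK phiN.
by have := phiD_le x y; lra.
Qed.

Let phiZ_pos (c : R) x : 0 < c -> phi (c *: x) = c * phi x.
Proof.
have le d z : 0 < d -> phi (d *: z) <= d * phi z.
  move=> d0; rewrite -ler_pdivrMl//; apply/ler_addgt0Pr => e e0.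
  rewrite ler_pdivrMl//; apply: phi_le.
  have /phi_lt Gz : phi z < phi z + e by lra.
  apply: filterS (filterI G_gt0 Gz) => w [/= w1 zw].
  exact: below_onZ (ltW w1) zw.
move=> c0; apply/eqP; rewrite eq_le le//=.
have := le c^-1 (c *: x); rewrite invr_gt0 scalerA mulVf ?gt_eqF// scale1r.
by move=> /(_ c0); rewrite ler_pdivlMl.
Qed.

Let phiZ (c : R) x : phi (c *: x) = c * phi x.
Proof.
have [c0|c0|<-] := ltgtP 0 c; first exact: phiZ_pos.
  by rewrite -[c]opprK scaleNr phiN phiZ_pos ?oppr_gt0// !mulNr.
by rewrite scale0r mul0r phi0.
Qed.

Let phi_mono x y : x <= y -> phi x <= phi y.
Proof.
move=> xy; apply/ler_addgt0Pr => e e0; apply: phi_le.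
have /phi_lt Gy : phi y < phi y + e by lra.
apply: filterS Gy => w /=; apply: riesz_disjointS (lexx _).
apply: riesz_pos_le (riesz_pos_ge0 _) _; apply: le_trans (riesz_le_pos _).
by rewrite riesz_leDr.
Qed.

Lemma ultrafilter_character : is_character phi.
Proof.
split=> [c x y|x y|]; first by rewrite phiD phiZ.
  apply/eqP; rewrite eq_le ge_max !phi_mono ?riesz_le_joinl ?riesz_le_joinr//.
  rewrite !andbT; apply/ler_addgt0Pr => e e0; apply: phi_le.
  have /phi_lt Gx : phi x < Num.max (phi x) (phi y) + e.
    by rewrite ltr_pwDr// le_max lexx.
  have /phi_lt Gy : phi y < Num.max (phi x) (phi y) + e.
    by rewrite ltr_pwDr// le_max lexx orbT.
  by apply: filterS (filterI Gx Gy) => w [/= xw yw]; exact: below_on_join.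
apply/eqP; rewrite eq_le; apply/andP; split.
  by apply: phi_le; apply: filterS filterT => w _; exact: below_on_unit1.
apply: lb_le_inf; first exact: (levels_has_inf u).1.
move=> t Gt; have [w [/= w1 ut]] := filter_ex (filterI G_gt0 Gt).
exact: below_on_unit ut.
Qed.

Lemma ultrafilter_character_ge x (t : R) : (forall w, 0 < w -> w <= w0 ->
  below_on w (- x) (- t)) -> t <= phi x.
Proof.
move=> xt; rewrite -lerN2 -phiN; apply: phi_le; apply: w0G => w w1 ww0.
by exists w; [rewrite w1 lexx|move=> v v0 vw; exact: xt (le_trans vw ww0)].
Qed.

End UltrafilterCharacter.

Hypothesis E_complete : dedekind_complete E.

(** Start the forcing from the condition (x - d u)^+, which is nonzero for some
    d > 0 by the Archimedean property. *)
Lemma character_gt0 x : ~~ (x <= 0) -> exists2 phi, is_character phi & 0 < phi x.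
Proof.
move=> xN0.
have [d d0 xd] : exists2 d : R, 0 < d & ~~ (x <= d *: u).
  apply: contrapT => /forall2NP xd; move/negP: xN0; apply.
  apply: (@dedekind_archimedean _ _ _ u E_complete) => -[|n].
    by rewrite scale0r.
  have n0 : (0 : R) < n.+1%:R by rewrite ltr0n.
  have [|/negP/negPn xu] := xd (n.+1%:R^-1); first by rewrite invr_gt0.
  have := riesz_leZ _ _ _ (ltW n0) xu.
  by rewrite scalerA divff ?gt_eqF// scale1r.
set w0 := riesz_pos (x - d *: u).
have w0_gt0 : 0 < w0.
  rewrite lt_neqAle riesz_pos_ge0 andbT; apply: contraNneq xd => w0E.
  by rewrite -[_ *: _]add0r -riesz_lerBlDr w0E; exact: riesz_le_pos.
have [G [GU w0G]] := ultraFilterLemma (dense_below_proper w0_gt0).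
eexists; first exact: ultrafilter_character GU w0G.
apply: lt_le_trans d0 _; apply: (ultrafilter_character_ge GU w0G).
move=> w w1 ww0; move=> z z0 zx zw.
apply: (@riesz_disjoint_posN _ _ (x - d *: u)) => //.
  exact: le_trans zw ww0.
by rewrite opprB addrC; rewrite scaleNr opprK in zx.
Qed.

End Characters.

(** * The representation by continuous functions on the spectrum *)

Lemma ultra_fmap (T U : Type) (f : T -> U) (G : set_system T) :
  UltraFilter G -> UltraFilter (f @ G).
Proof.
move=> GU; split=> [|H HF GH]; first exact: fmap_proper_filter.
apply/seteqP; split=> A; last exact: GH.
move=> HA; have [//|GnA] := in_ultra_setVsetC (f @^-1` A) GU.
have HnA : H (~` A) by apply: GH.
by have /filter_ex[x []] : H (A `&` ~` A) by exact: filterI.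
Qed.

(** The image ultrafilter lives on the compact interval from - m to m. *)
Lemma ultra_bounded_cvg (R : realType) (T : Type) (G : set_system T)
    (f : T -> R) (m : R) :
  UltraFilter G -> (forall t, `|f t| <= m) -> exists l : R, f @ G --> l.
Proof.
move=> GU fm; have := @segment_compact R (- m) m; rewrite compact_ultra.
move=> /(_ _ (ultra_fmap f GU)) [|l [_ ?]]; last by exists l.
apply: (@filterS _ G _ setT _ _ filterT) => t _.
by rewrite /= in_itv/= -ler_norml; exact: fm.
Qed.

Definition spectrum (R : realType) (E : rieszType R) (u : E) :=
  {phi : E -> R | is_character u phi}.

Section SpectrumTopology.
Variables (R : realType) (E : rieszType R) (u : E).

Definition spectrum_eval (x : E) (k : spectrum u) : R := sval k x.

HB.instance Definition _ := gen_eqMixin (spectrum u).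
HB.instance Definition _ := gen_choiceMixin (spectrum u).
HB.instance Definition _ := Topological.copy (spectrum u)
  (sup_topology (fun x : E =>
    Topological.class (initial_topology (spectrum_eval x)))).

Lemma spectrum_cvg (F : set_system (spectrum u)) (k : spectrum u) :
  Filter F -> (forall x, spectrum_eval x @ F --> spectrum_eval x k) -> F --> k.
Proof.
move=> FF Fk; apply/cvg_sup => x A.
rewrite nbhsE => -[_ [[B Bo <-] Bk] BA].
by apply: filterS BA _; apply: Fk; exact: open_nbhs_nbhs.
Qed.

Lemma spectrum_eval_continuous x : continuous (spectrum_eval x).
Proof.
move=> k A kA; have /cvg_sup /(_ x) : nbhs k --> k by exact: cvg_id.
apply; exact: (@initial_continuous _ _ (spectrum_eval x)).
Qed.

Lemma spectrum_ext (k l : spectrum u) :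
  (forall x, spectrum_eval x k = spectrum_eval x l) -> k = l.
Proof.
case: k l => [phi phiP] [psi psiP] kl.
by apply: eq_exist; apply/funext => x; exact: kl.
Qed.

Lemma spectrum_hausdorff : hausdorff_space (spectrum u).
Proof.
move=> k l kl; apply: spectrum_ext => x.
apply: (@norm_hausdorff R R) => A B kA lB.
have [m [Am Bm]] := kl _ _ (@spectrum_eval_continuous x _ _ kA)
  (@spectrum_eval_continuous x _ _ lB).
by exists (spectrum_eval x m).
Qed.

Lemma spectrum_evalP (k : spectrum u) : is_character u (spectrum_eval ^~ k).
Proof. by case: k. Qed.

Section CharacterTheory.
Variable phi : E -> R.
Hypothesis phiP : is_character u phi.

Lemma character0 : phi 0 = 0.
Proof.
have := character_linear phiP 1 0 0.
by rewrite scaler0 addr0 mul1r => h; lra.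
Qed.

Lemma characterZ c x : phi (c *: x) = c * phi x.
Proof. by have := character_linear phiP c x 0; rewrite addr0 character0 addr0. Qed.

Lemma characterD x y : phi (x + y) = phi x + phi y.
Proof. by have := character_linear phiP 1 x y; rewrite scale1r mul1r. Qed.

Lemma characterN x : phi (- x) = - phi x.
Proof. by rewrite -scaleN1r characterZ mulN1r. Qed.

Lemma character_abs x : phi (riesz_abs x) = `|phi x|.
Proof.
rewrite (character_join phiP) characterN; have [x0|x0] := ler0P (phi x).
  by apply: max_r; lra.
by apply: max_l; lra.
Qed.

Lemma character_mono x y : x <= y -> phi x <= phi y.
Proof.
move=> xy; have <- : riesz_join x y = y.
  by apply/eqP; rewrite eq_le riesz_leUx xy lexx riesz_le_joinr.
by rewrite (character_join phiP) le_max lexx.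
Qed.

Lemma character_bound x m : riesz_abs x <= m *: u -> `|phi x| <= m.
Proof.
by move=> /character_mono; rewrite character_abs characterZ (character_unit phiP) mulr1.
Qed.

End CharacterTheory.

Hypothesis u_ge0 : 0 <= u.
Hypothesis uP : order_unit u.

(** Along an ultrafilter all evaluations converge, because they are bounded, and
    the defining identities of a character pass to the limit. *)
Lemma spectrum_compact : compact [set: spectrum u].
Proof.
rewrite compact_ultra => G GU _.
have eval_cvg x : exists l : R, spectrum_eval x @ G --> l.
  have [m m0 xm] := uP x; apply: (@ultra_bounded_cvg _ _ _ _ m GU) => k.
  exact: character_bound (spectrum_evalP k) _ _ xm.
pose phi x := projT1 (cid (eval_cvg x)).
have phiP x : spectrum_eval x @ G --> phi x by rewrite /phi; case: cid.
have phi_lim x (g : spectrum u -> R) l :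
    (forall k, spectrum_eval x k = g k) -> g @ G --> l -> phi x = l.
  move=> /funext <- xl.
  exact: (@cvg_unique R (@norm_hausdorff R R) _ _ _ _ (phiP x) xl).
have phi_char : is_character u phi.
  split=> [c x y|x y|].
  - apply: (phi_lim _ (fun k => c * spectrum_eval x k + spectrum_eval y k)).
      by move=> k; rewrite (character_linear (spectrum_evalP k)).
    by apply: cvgD (phiP y); apply: cvgM (phiP x); exact: cvg_cst.
  - apply: (phi_lim _ (fun k => (spectrum_eval x k + spectrum_eval y k +
        `|spectrum_eval x k - spectrum_eval y k|) / 2)).
      by move=> k; rewrite (character_join (spectrum_evalP k)) maxr_absE.
    rewrite maxr_absE; apply: cvgM; last exact: cvg_cst.
    apply: cvgD; first by apply: cvgD.
    by apply: cvg_norm; apply: cvgB.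
  - apply: (phi_lim _ (fun=> 1)); last exact: cvg_cst.
    by move=> k; rewrite (character_unit (spectrum_evalP k)).
by exists (exist _ phi phi_char); split=> //; apply: spectrum_cvg => x.
Qed.

Hypothesis E_complete : dedekind_complete E.

Lemma spectrum_separates x y : spectrum_eval x = spectrum_eval y -> x = y.
Proof.
move=> xy; apply/eqP; rewrite -subr_eq0 eq_le.
suff le0 z : spectrum_eval z = cst 0 -> z <= 0.
  apply/andP; split; [|rewrite -oppr0 -[x - y]opprK; apply: riesz_leN];
  apply: le0; apply/funext => k;
  have ck := spectrum_evalP k; have := congr1 (fun f => f k) xy => /= xyk;
  rewrite ?(characterN ck) (characterD ck) (characterN ck) xyk.
    by rewrite subrr.
  by rewrite subrr oppr0.
move=> z0; apply: contrapT => /negP.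
move=> /(character_gt0 u_ge0 uP E_complete)[phi phiP].
by have := congr1 (fun f => f (exist _ phi phiP)) z0 => /= ->; rewrite ltxx.
Qed.

Lemma spectrum_leP x y :
  x <= y <-> forall k : spectrum u, spectrum_eval x k <= spectrum_eval y k.
Proof.
split=> [xy k|xy]; first exact: character_mono (spectrum_evalP k) _ _ xy.
have <- : riesz_join x y = y; last exact: riesz_le_joinl.
apply: spectrum_separates; apply/funext => k.
by rewrite (character_join (spectrum_evalP k)); apply: max_r.
Qed.

(** The compactness step of the lattice Stone-Weierstrass theorem.  If no element
    of Q dominated h everywhere, the sets where y <= h, for y in Q, would
    generate a proper filter, as Q is closed under joins; a cluster point of that
    filter contradicts the hypothesis that h is dominated at each point. *)
Lemma spectrum_join_dominates (Q : set E) (h : spectrum u -> R) :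
  continuous h -> Q !=set0 ->
  (forall x y, Q x -> Q y -> Q (riesz_join x y)) ->
  (forall k, exists2 y, Q y & h k < spectrum_eval y k) ->
  exists2 y, Q y & forall k, h k < spectrum_eval y k.
Proof.
move=> hc Q0 Qjoin Qh; apply: contrapT => noy.
pose F := filter_from Q (fun y => [set k | spectrum_eval y k <= h k]).
have FF : ProperFilter F.
  apply: filter_from_proper; last first.
    move=> y Qy; apply: contrapT => /forallNP yh; apply: noy; exists y => // k.
    by rewrite ltNge; apply/negP; exact: yh.
  apply: filter_from_filter => // x y Qx Qy.
  exists (riesz_join x y); first exact: Qjoin.
  by move=> k /=; rewrite (character_join (spectrum_evalP k)) ge_max => /andP[].
have [k [_ kF]] := spectrum_compact FF filterT.
have [y Qy hy] := Qh k.
have : nbhs k [set l | 0 < spectrum_eval y l - h l].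
  have yhk : (fun l => spectrum_eval y l - h l) @ k --> spectrum_eval y k - h k.
    exact: cvgB (@spectrum_eval_continuous y k) (hc k).
  by apply: (cvgr_gt _ yhk); rewrite subr_gt0.
move=> /(kF _ _ (ex_intro2 _ _ y Qy (@subset_refl _ _)))[l [/= yl]].
by rewrite subr_gt0 ltNge yl.
Qed.

(** Interpolate h at two points, take joins to get above h - d everywhere while
    keeping the value at one point, then take meets over these points to get
    below h + d.  Meets are treated as joins of opposites. *)
Lemma spectrum_approx (h : spectrum u -> R) (d : R) : continuous h -> 0 < d ->
  exists y, forall k, `|spectrum_eval y k - h k| < d.
Proof.
move=> hc d0.
have two k l : exists2 y, spectrum_eval y k = h k & spectrum_eval y l = h l.
  have [kl|kl] := pselect (k = l).
    exists (h k *: u); rewrite -?kl (characterZ (spectrum_evalP k));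
    by rewrite (character_unit (spectrum_evalP k)) mulr1.
  have [x xkl] : exists x, spectrum_eval x k != spectrum_eval x l.
    apply: contrapT => /forallNP xkl; apply: kl; apply: spectrum_ext => x.
    by apply/eqP; have /negP/negPn := xkl x.
  pose c := (h k - h l) / (spectrum_eval x k - spectrum_eval x l).
  have cE : c * (spectrum_eval x k - spectrum_eval x l) = h k - h l.
    by rewrite /c divfK// subr_eq0.
  (* The affine function of x through the two prescribed values. *)
  exists (c *: x + (h k - c * spectrum_eval x k) *: u).
    rewrite (character_linear (spectrum_evalP k)) (characterZ (spectrum_evalP k)).
    by rewrite (character_unit (spectrum_evalP k)); lra.
  rewrite (character_linear (spectrum_evalP l)) (characterZ (spectrum_evalP l)).
  by rewrite (character_unit (spectrum_evalP l)); lra.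
have one k : exists2 y, spectrum_eval y k = h k &
    forall l, h l - d < spectrum_eval y l.
  apply: (@spectrum_join_dominates [set y | spectrum_eval y k = h k]
    (fun l => h l - d)) => [l||x y|l].
  - by apply: cvgB (hc l) _; exact: cvg_cst.
  - by have [y] := two k k; exists y.
  - by rewrite /= (character_join (spectrum_evalP k)) => -> ->; exact: maxxx.
  - by have [y yk yl] := two k l; exists y => //; rewrite yl; lra.
have [||||y Qy hy] := @spectrum_join_dominates
  [set y | forall l, spectrum_eval y l < d - h l] (fun l => - h l - d).
- by move=> l; exact: cvgB (cvgN (hc l)) (cvg_cst _).
- have [[k _]|nok] := pselect (exists k : spectrum u, True).
    have [y _ hy] := one k; exists (- y) => l.
    by rewrite (characterN (spectrum_evalP l)); have := hy l; lra.
  by exists 0 => l; case: nok; exists l.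
- move=> x y Qx Qy l; rewrite (character_join (spectrum_evalP l)) gt_max.
  by rewrite Qx Qy.
- move=> k; have [y yk hy] := one k; exists (- y).
    by move=> l; rewrite (characterN (spectrum_evalP l)); have := hy l; lra.
  by rewrite (characterN (spectrum_evalP k)) yk; lra.
exists (- y) => l; rewrite (characterN (spectrum_evalP l)) ltr_norml.
by have := Qy l; have := hy l => /= ? ?; apply/andP; split; lra.
Qed.

(** The preimage of h is the supremum of the elements below h; the uniform
    approximations of h bound this supremum from both sides. *)
Lemma spectrum_surj (h : spectrum u -> R) :
  continuous h -> exists x, spectrum_eval x = h.
Proof.
move=> hc; have approx d (d0 : 0 < d) := spectrum_approx hc d0.
pose A := [set y : E | forall k, spectrum_eval y k <= h k].
have shift y (c : R) k : spectrum_eval (y + c *: u) k = spectrum_eval y k + c.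
  rewrite (characterD (spectrum_evalP k)) (characterZ (spectrum_evalP k)).
  by rewrite (character_unit (spectrum_evalP k)) mulr1.
have lowA y d : (forall k, `|spectrum_eval y k - h k| < d) -> A (y + (- d) *: u).
  by move=> yh k; rewrite shift; have := yh k; rewrite ltr_norml => /andP[]; lra.
have upA y d : (forall k, `|spectrum_eval y k - h k| < d) -> ubound A (y + d *: u).
  move=> yh z Az; apply/spectrum_leP => k; rewrite shift.
  by have := yh k; have := Az k; rewrite ltr_norml => ? /andP[]; lra.
have [y1 y1h] := approx 1 ltr01.
have [||s [sub sleast]] := E_complete (A := A).
- by exists (y1 + (- 1) *: u); exact: lowA.
- by exists (y1 + 1 *: u); exact: upA.
exists s; apply/funext => k; apply/eqP; rewrite eq_le; apply/andP; split.
  apply/ler_addgt0Pr => d d0; have d20 : 0 < d / 2 by lra.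
  have [y yh] := approx _ d20.
  have /spectrum_leP/(_ k) := sleast _ (upA _ _ yh).
  by rewrite shift; have := yh k; rewrite ltr_norml => /andP[]; lra.
apply/ler_addgt0Pr => d d0; have d20 : 0 < d / 2 by lra.
have [y yh] := approx _ d20.
have /spectrum_leP/(_ k) := sub _ (lowA _ _ yh).
by rewrite shift; have := yh k; rewrite ltr_norml => /andP[]; lra.
Qed.

Theorem spectrum_representation : CK_representation u spectrum_eval.
Proof.
split.
- exact: spectrum_compact.
- exact: spectrum_hausdorff.
- exact: spectrum_eval_continuous.
- by move=> c x y k; exact: character_linear (spectrum_evalP k) _ _ _.
- by move=> x y k; exact: character_join (spectrum_evalP k) _ _.
- by move=> k; exact: character_unit (spectrum_evalP k).
- exact: spectrum_separates.
- exact: spectrum_surj.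
Qed.

End SpectrumTopology.

(** * Powers of real numbers *)

Section RealPowers.
Variable R : realType.
Implicit Types s t p q r m : R.

(** Young's inequality for s and t^(p-1) with the exponents p and p / (p-1). *)
Lemma powR_tangent p s t : 1 < p -> 0 <= s -> 0 <= t ->
  p * t `^ (p - 1) * s - (p - 1) * t `^ p <= s `^ p.
Proof.
move=> p1 s0 t0; have p0 : 0 < p by lra.
have p10 : 0 < p - 1 by lra.
have pN0 : p != 0 by rewrite gt_eqF.
have p1N0 : p - 1 != 0 by rewrite gt_eqF.
have := @conjugate_powR R s (t `^ (p - 1)) p (p / (p - 1)) s0 (powR_ge0 _ _) p0.
rewrite divr_gt0// => /(_ isT); rewrite -powRrM.
have -> : (p - 1) * (p / (p - 1)) = p by field; rewrite ?pN0 ?p1N0.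
have -> : p^-1 + (p / (p - 1))^-1 = 1 by field; rewrite ?pN0 ?p1N0.
move=> /(_ erefl) /(ler_wpM2l (ltW p0)).
have -> : p * (s `^ p / p + t `^ p / (p / (p - 1))) = s `^ p + (p - 1) * t `^ p.
  by field; rewrite ?pN0 ?p1N0.
by lra.
Qed.

Lemma powR_tangent_touch p s : 1 < p -> 0 <= s ->
  p * s `^ (p - 1) * s - (p - 1) * s `^ p = s `^ p.
Proof.
by move=> p1 s0; rewrite -mulrA [_ `^ _ * s]mulrC mulr_powRB1//; [ring|lra].
Qed.

(** By the tangent line at the larger of the two points, whose slope is at most
    p m^(p-1). *)
Lemma powR_lipschitz p m s t : 1 < p -> 0 <= s <= m -> 0 <= t <= m ->
  `|s `^ p - t `^ p| <= p * m `^ (p - 1) * `|s - t|.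
Proof.
move=> p1; have p0 : 0 < p by lra.
wlog st : s t / t <= s => [hw sm tm|/andP[s0 sm] /andP[t0 tm]].
  have [ts|/ltW st] := leP t s; first exact: hw.
  by rewrite distrC [`|s - t|]distrC; exact: hw.
rewrite !ger0_norm ?subr_ge0//; last first.
  by apply: ge0_ler_powR => //; rewrite ?nnegrE// ltW.
have := powR_tangent p1 t0 s0; have := powR_tangent_touch p1 s0 => touch tang.
apply: (@le_trans _ _ (p * s `^ (p - 1) * (s - t))); first by lra.
rewrite ler_wpM2r ?subr_ge0// ler_wpM2l ?(ltW p0)//.
by apply: ge0_ler_powR => //; rewrite ?nnegrE//; lra.
Qed.

(** At a zero of h, continuity follows from h < e^(1/r) nearby. *)
Lemma continuous_powR (T : topologicalType) (h : T -> R) r : 0 < r ->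
  (forall z, 0 <= h z) -> continuous h -> continuous (fun z => h z `^ r).
Proof.
move=> r0 h0 hc z; have := h0 z; rewrite le_eqVlt => /predU1P[hz0|hz_gt0].
  rewrite /continuous_at -hz0 powR0 ?gt_eqF//; apply/cvgr0Pnorm_lt => e e0.
  have hlt : h @ z --> 0 by rewrite hz0; exact: hc.
  have e'0 : 0 < e `^ r^-1 by exact: powR_gt0.
  apply: filterS (cvgr_lt _ hlt _ e'0) => x hx.
  rewrite ger0_norm ?powR_ge0//.
  have -> : e = (e `^ r^-1) `^ r by rewrite -powRrM mulVf ?gt_eqF// powRr1// ltW.
  by apply: gt0_ltr_powR; rewrite ?nnegrE ?powR_ge0.
apply: (@continuous_comp _ _ _ h (fun x => x `^ r)); first exact: hc.
apply: differentiable_continuous; apply/derivable1_diffP.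
by apply: derivable_powR; rewrite in_itv/= hz_gt0.
Qed.

End RealPowers.

Section RealHoelder.
Variables (R : realType) (p q : R).
Hypotheses (p_gt0 : 0 < p) (q_gt0 : 0 < q) (pq : p^-1 + q^-1 = 1).
Implicit Types s t x y A B c : R.

(** The coefficients of the two powers in Young's inequality for s / x and t / y,
    after multiplication by x y. *)
Definition young_coef1 x y := x * y / x `^ p / p.
Definition young_coef2 x y := x * y / y `^ q / q.

Lemma scaled_young x y s t : 0 < x -> 0 < y -> 0 <= s -> 0 <= t ->
  s * t <= young_coef1 x y * s `^ p + young_coef2 x y * t `^ q.
Proof.
move=> x0 y0 s0 t0.
have div_powR z w r : 0 < z -> 0 <= w -> (w / z) `^ r = w `^ r / z `^ r.
  move=> z0 w0; have zr0 : 0 < z `^ r by exact: powR_gt0.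
  apply: (mulIf (lt0r_neq0 zr0)); rewrite divfK ?gt_eqF//.
  have wz0 : 0 <= w / z by rewrite divr_ge0// ltW.
  by rewrite -powRM ?(ltW z0)// divfK ?gt_eqF.
have sx0 : 0 <= s / x by rewrite divr_ge0// ltW.
have ty0 : 0 <= t / y by rewrite divr_ge0// ltW.
have xy0 : 0 < x * y by rewrite mulr_gt0.
have := conjugate_powR sx0 ty0 p_gt0 q_gt0 pq.
rewrite !div_powR// => /(ler_wpM2l (ltW xy0)).
have -> : x * y * (s / x * (t / y)) = s * t.
  by field; rewrite !gt_eqF.
by rewrite mulrDr /young_coef1 /young_coef2 => h; apply: le_trans h _;
  rewrite le_eqVlt; apply/orP; left; apply/eqP; ring.
Qed.

(** The choice x = A^(1/p) + d and y = B^(1/q) + d, with d > 0, makes the right-hand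
    side at most x y.  Adding d keeps x and y positive when A or B vanishes. *)
Lemma optimal_young A B c : 0 <= A -> 0 <= B ->
  (forall x y, 0 < x -> 0 < y ->
    c <= young_coef1 x y * A + young_coef2 x y * B) ->
  c <= A `^ p^-1 * B `^ q^-1.
Proof.
move=> A0 B0 cAB; set x0 := A `^ p^-1; set y0 := B `^ q^-1.
have x00 : 0 <= x0 by exact: powR_ge0.
have y00 : 0 <= y0 by exact: powR_ge0.
have ratio_le1 C r d : 0 < r -> 0 <= C -> 0 < d -> C / (C `^ r^-1 + d) `^ r <= 1.
  move=> r0 C0 d0; have z0 : 0 < C `^ r^-1 + d by rewrite ltr_wpDl ?powR_ge0.
  rewrite ler_pdivrMr ?mul1r ?powR_gt0//.
  rewrite -{1}[C](powRr1 C0) -(mulVf (lt0r_neq0 r0)) powRrM.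
  by apply: ge0_ler_powR; rewrite ?nnegrE ?(ltW r0) ?(ltW z0) ?powR_ge0 ?lerDl ?(ltW d0).
have factor z X Y :
    z / X / p * A + z / Y / q * B = z * (A / X * p^-1 + B / Y * q^-1).
  by ring.
have shifted d : 0 < d -> c <= (x0 + d) * (y0 + d).
  move=> d0; have xd0 : 0 < x0 + d by lra.
  have yd0 : 0 < y0 + d by lra.
  have xy0 : 0 < (x0 + d) * (y0 + d) by exact: mulr_gt0.
  apply: le_trans (cAB _ _ xd0 yd0) _.
  rewrite /young_coef1 /young_coef2 factor.
  rewrite -[leRHS]mulr1 ler_wpM2l ?(ltW xy0)// -pq.
  by apply: lerD; apply: ler_piMl; rewrite ?invr_ge0 ?(ltW p_gt0) ?(ltW q_gt0)//;
    exact: ratio_le1.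
apply/ler_addgt0Pr => e e0.
pose d := Num.min 1 (e / (x0 + y0 + 1)).
have xy1 : 0 < x0 + y0 + 1 by lra.
have d0 : 0 < d by rewrite lt_min ltr01 divr_gt0.
have d1 : d <= 1 by rewrite ge_min lexx.
have de : d * (x0 + y0 + 1) <= e by rewrite -ler_pdivlMr// ge_min lexx orbT.
apply: le_trans (shifted d d0) _.
have : d * d <= d * 1 by rewrite ler_wpM2l ?(ltW d0).
by lra.
Qed.

End RealHoelder.

(** * Powers and products in a represented space *)

Section Representations.
Variables (R : realType) (E : rieszType R) (u : E).
Implicit Types x y z : E.

Section OneRepresentation.
Variables (K : topologicalType) (Phi : E -> K -> R).
Hypothesis repr : CK_representation u Phi.

Lemma CK_character k : is_character u (Phi ^~ k).
Proof.
by split=> [c x y|x y|]; [exact: CK_linear repr _ _ _ _|exact: CK_join repr _ _ _|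
  exact: CK_unit repr _].
Qed.

Lemma CK_leP x y : x <= y <-> forall k, Phi x k <= Phi y k.
Proof.
split=> [xy k|xy]; first exact: character_mono (CK_character k) _ _ xy.
have <- : riesz_join x y = y; last exact: riesz_le_joinl.
apply: (CK_inj repr); apply/funext => k.
by rewrite (CK_join repr); apply: max_r.
Qed.

Lemma CK_ge0P x : 0 <= x <-> forall k, 0 <= Phi x k.
Proof.
split=> [/CK_leP x0 k|x0]; last apply/CK_leP => k.
  by rewrite -(character0 (CK_character k)).
by rewrite (character0 (CK_character k)).
Qed.

Lemma CK_lincomb c d x y k :
  Phi (c *: x + d *: y) k = c * Phi x k + d * Phi y k.
Proof. by rewrite (CK_linear repr) (characterZ (CK_character k)). Qed.

(** The tangent line of the p-th power at the point t, evaluated at x. *)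
Definition power_tangent p x t := (p * t `^ (p - 1)) *: x + (- ((p - 1) * t `^ p)) *: u.

Lemma CK_power_tangent p x t k : Phi (power_tangent p x t) k =
  p * t `^ (p - 1) * Phi x k - (p - 1) * t `^ p.
Proof. by rewrite CK_lincomb (CK_unit repr) mulr1. Qed.

(** At each point k the tangent at t = Phi x k touches the p-th power, so an upper
    bound of all tangents lies above the p-th power. *)
Lemma CK_power_supremum p x y : 1 < p -> 0 <= x ->
  (forall k, Phi y k = Phi x k `^ p) ->
  supremums [set power_tangent p x t | t in [set t | 0 <= t]] y.
Proof.
move=> p1 /CK_ge0P x0 yxp; split=> [_ [t t0 <-]|z zub]; apply/CK_leP => k.
  by rewrite CK_power_tangent yxp; exact: powR_tangent.
rewrite yxp -(powR_tangent_touch p1 (x0 k)) -CK_power_tangent.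
by apply: (CK_leP _ _).1; apply: zub; exists (Phi x k); rewrite //= x0.
Qed.

Lemma CK_power_exists r x : 0 < r -> 0 <= x ->
  exists y, forall k, Phi y k = Phi x k `^ r.
Proof.
move=> r0 /CK_ge0P x0.
have [y yx] := CK_surj repr (continuous_powR r0 x0 (@CK_continuous _ _ _ _ _ repr x)).
by exists y => k; rewrite yx.
Qed.

End OneRepresentation.

Section TwoRepresentations.
Variables (K L : topologicalType) (Phi : E -> K -> R) (Psi : E -> L -> R).
Hypotheses (Phi_repr : CK_representation u Phi) (Psi_repr : CK_representation u Psi).

Lemma CK_power_transfer_gt1 p x y : 1 < p -> 0 <= x ->
  (forall l, Psi y l = Psi x l `^ p) -> forall k, Phi y k = Phi x k `^ p.
Proof.
move=> p1 x0 yxp; have p0 : 0 < p by lra.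
have [z zxp] := CK_power_exists Phi_repr p0 x0.
have <- // : z = y.
apply: is_subset1_supremums (CK_power_supremum Phi_repr p1 x0 zxp) _.
exact (CK_power_supremum Psi_repr p1 x0 yxp).
Qed.

(** For r < 1 the roles are exchanged: x is the power of y with exponent
    1 / r > 1. *)
Lemma CK_power_transfer r x y : 0 < r -> 0 <= x ->
  (forall l, Psi y l = Psi x l `^ r) -> forall k, Phi y k = Phi x k `^ r.
Proof.
move=> r0 x0 yxr k; have Phix0 := (CK_ge0P Phi_repr x).1 x0.
have Psix0 := (CK_ge0P Psi_repr x).1 x0.
have [r1|r1|r1] := ltgtP r 1; last 2 first.
- exact: CK_power_transfer_gt1 yxr k.
- suff -> : y = x by rewrite r1 powRr1.
  by apply: (CK_inj Psi_repr); apply/funext => l; rewrite yxr r1 powRr1.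
have y0 : 0 <= y by apply/(CK_ge0P Psi_repr) => l; rewrite yxr powR_ge0.
have rV1 : 1 < r^-1 by rewrite invf_gt1.
rewrite (@CK_power_transfer_gt1 r^-1 y x rV1 y0) => [|l].
  by rewrite -powRrM mulVf ?gt_eqF// powRr1// (CK_ge0P Phi_repr y).1.
by rewrite yxr -powRrM divff ?gt_eqF// powRr1.
Qed.

End TwoRepresentations.

(** The representation used to define the power is arbitrary and may vary with x;
    by [CK_power_transfer] it can be replaced with any other one. *)
Theorem riesz_powerE (K : topologicalType) (Phi : E -> K -> R) r x k :
  CK_representation u Phi -> 0 < r -> 0 <= x ->
  Phi (riesz_power u r x) k = Phi x k `^ r.
Proof.
move=> repr r0 x0; rewrite /riesz_power; case: xgetP => [y _|noy].
  move=> [L [Psi [Psi_repr yx]]].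
  exact: CK_power_transfer repr Psi_repr _ _ _ r0 x0 yx k.
have [y yx] := CK_power_exists repr r0 x0.
by case: (noy y); exists K, Phi.
Qed.

Section Multiplication.
Variables (mul : E -> E -> E) (phi : E -> R).
Hypotheses (mulP : f_algebra_mul mul u) (phiP : is_character u phi).
Hypothesis uP : order_unit u.

(** If phi a = 0 with a >= 0 and |b| <= m u, then |a b| <= m a forces phi (a b) = 0.
    So the kernel of phi is an ideal, and x - phi x u belongs to it. *)
Lemma f_algebra_character x y : phi (mul x y) = phi x * phi y.
Proof.
have mulDl := f_mulDl mulP; have mulZl := f_mulZl mulP; have mulC := f_mulC mulP.
have mulDr a b c : mul a (b + c) = mul a b + mul a c.
  by rewrite mulC mulDl !(mulC a).
have mulZr (c : R) a b : mul a (c *: b) = c *: mul a b.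
  by rewrite mulC mulZl mulC.
have mulu a : mul a u = a by rewrite mulC (f_mul1 mulP).
have mul_le a b c : 0 <= a -> b <= c -> mul a b <= mul a c.
  move=> a0 bc; rewrite -riesz_subr_ge0 -[- mul a b]scaleN1r -mulZr -mulDr.
  by rewrite scaleN1r; apply: (f_mul_ge0 mulP) => //; rewrite riesz_subr_ge0.
have pos0 a b : 0 <= a -> phi a = 0 -> phi (mul a b) = 0.
  move=> a0 pa0; have [m m0 /riesz_abs_leP[bm bNm]] := uP b.
  have le b' : b' <= m *: u -> phi (mul a b') <= 0.
    move=> /(mul_le _ _ _ a0)/(character_mono phiP).
    by rewrite mulZr mulu (characterZ phiP) pa0 mulr0.
  have := le _ bNm; rewrite -[- b]scaleN1r mulZr (characterZ phiP).
  by have := le _ bm => ? ?; lra.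
have ker a b : phi a = 0 -> phi (mul a b) = 0.
  move=> pa0; have -> : a = riesz_pos a + (-1) *: (riesz_pos a - a).
    by rewrite scaleN1r opprB addrC subrK.
  have pa0' : phi (riesz_pos a) = 0.
    by rewrite (character_join phiP) pa0 (character0 phiP) maxxx.
  rewrite mulDl mulZl (characterD phiP) (characterZ phiP) !pos0 ?riesz_pos_ge0//.
  - by rewrite mulr0 addr0.
  - by rewrite riesz_subr_ge0 riesz_le_pos.
  - by rewrite (characterD phiP) (characterN phiP) pa0 pa0' subrr.
have {1}-> : x = (x + (- phi x) *: u) + phi x *: u.
  by rewrite scaleNr subrK.
rewrite mulDl (characterD phiP) ker ?add0r.
  by rewrite mulZl (characterZ phiP) (f_mul1 mulP).
by rewrite (characterD phiP) (characterZ phiP) (character_unit phiP); lra.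
Qed.

End Multiplication.

End Representations.

(** * Upper integrals and integrability *)

Section IntervalSums.
Variables (R : realType) (E : rieszType R).
Implicit Types (W V : R -> R -> E) (a b c d : R) (s t : seq R).

Fixpoint itv_sum W a s : E :=
  if s is c :: s' then W a c + itv_sum W c s' else 0.

Lemma itv_sum_nth W a b s :
  \sum_(0 <= i < size s) W (nth b (a :: s) i) (nth b (a :: s) i.+1) =
  itv_sum W a s.
Proof.
elim: s a => [|c s ih] a; first by rewrite big_nil.
by rewrite big_nat_recl //= -(ih c).
Qed.

Lemma itv_sumD W V a s :
  itv_sum (fun c d => W c d + V c d) a s = itv_sum W a s + itv_sum V a s.
Proof. by elim: s a => [|c s ih] a /=; rewrite ?addr0// ih addrACA. Qed.

Lemma itv_sumZ (k : R) W a s :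
  itv_sum (fun c d => k *: W c d) a s = k *: itv_sum W a s.
Proof. by elim: s a => [|c s ih] a /=; rewrite ?scaler0// ih scalerDr. Qed.

Definition le_itv a b W V := forall c d, a <= c -> c < d -> d <= b -> W c d <= V c d.

Lemma itv_sum_le a b W V s : le_itv a b W V -> itv_partition a b s ->
  itv_sum W a s <= itv_sum V a s.
Proof.
elim: s a => [//|c s ih] a WV abs /=.
have ac : a < c by have [/= /andP[]] := abs.
have cbs := itv_partition_cons abs; have cb := itv_partition_le cbs.
apply: riesz_leD; first exact: WV.
by apply: ih cbs => x y cx; apply: WV; exact: ltW (lt_le_trans ac cx).
Qed.

Lemma itv_sum_length (x : E) a b s : itv_partition a b s ->
  itv_sum (fun c d => (d - c) *: x) a s = (b - a) *: x.
Proof.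
elim: s a => [|c s ih] a abs /=.
  by rewrite (itv_partition_nil abs) subrr scale0r.
rewrite (ih _ (itv_partition_cons abs)) -scalerDl; congr (_ *: _); ring.
Qed.

(** The summands of an upper sum, viewed as a function of the interval, have this
    property, which is all that is needed for refinement to decrease the sums. *)
Definition superadditive a b W := forall c d e,
  a <= c -> c < d -> d < e -> e <= b -> W c d + W d e <= W c e.

Lemma superadditiveW a a' b W :
  a <= a' -> superadditive a b W -> superadditive a' b W.
Proof. by move=> aa Wab c d e ac; apply: Wab; exact: le_trans ac. Qed.

(** Merge the two partitions from the left.  If the next point c of s precedes the
    next point d of t, then c is also inserted in t, and superadditivity compares
    the two resulting pieces with the interval that ends at d.  The refinement
    does not depend on W. *)
Lemma common_refinement a b s t : itv_partition a b s -> itv_partition a b t ->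
  exists2 r, itv_partition a b r & forall W, superadditive a b W ->
    itv_sum W a r <= itv_sum W a s /\ itv_sum W a r <= itv_sum W a t.
Proof.
have [n] := ubnP (size s + size t); elim: n => // n ih in a s t *.
case: s => [|c s]; last case: t => [|d t].
- move=> _ abs; have ab := itv_partition_nil abs; rewrite ab in abs *.
  by move=> /itv_partitionxx ->; exists [::] => // W _; split; rewrite lexx.
- move=> _ abs abt; have ab := itv_partition_nil abt; rewrite ab in abs.
  by have := itv_partitionxx abs.
wlog cd : c d s t / c <= d => [hw st_n acs adt|].
  have [cd|/ltW dc] := leP c d; first exact: hw cd st_n acs adt.
  have [|r rP rW] := hw d c t s dc _ adt acs; first by rewrite addnC.
  by exists r => // W Wsup; have [] := rW W Wsup.
rewrite ltnS => st_n acs adt.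
have ac : a < c by have [/= /andP[]] := acs.
have ad : a < d by have [/= /andP[]] := adt.
have cbs := itv_partition_cons acs; have dbt := itv_partition_cons adt.
have cons r : itv_partition c b r -> itv_partition a b (c :: r).
  by move=> [cr lr]; split; rewrite //= ac.
move: cd; rewrite le_eqVlt => /predU1P[cd|cd].
  subst d; have [|r rP rW] := ih c s t _ cbs dbt.
    by apply: leq_trans st_n; rewrite /= addSn addnS ltnS leqnSn.
  exists (c :: r) => [|W Wsup /=]; first exact: cons.
  have [rs rt] := rW W (superadditiveW (ltW ac) Wsup).
  by split; apply: riesz_leD.
have cbdt : itv_partition c b (d :: t).
  by have [dt lt_] := dbt; split; rewrite //= cd.
have [|r rP rW] := ih c s (d :: t) _ cbs cbdt.
  by apply: leq_trans st_n; rewrite /= addSn.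
exists (c :: r) => [|W Wsup /=]; first exact: cons.
have [rs rt] := rW W (superadditiveW (ltW ac) Wsup).
split; first exact: riesz_leD.
apply: le_trans (riesz_leD (lexx _) rt) _.
rewrite /= addrA; apply: riesz_leD => //.
by apply: Wsup => //; exact: itv_partition_le dbt.
Qed.

End IntervalSums.

Section Suprema.
Variables (R : realType) (E : rieszType R).
Hypothesis E_complete : dedekind_complete E.
Implicit Types (A : set E) (x y z : E).

Lemma supremum_is_lub A : A !=set0 -> has_ubound A -> supremums A (supremum 0 A).
Proof.
move=> A0 Aub; rewrite /supremum ifF; last by apply/negbTE/set0P.
by case: xgetP => [x -> //|nosup]; have [x] := E_complete A0 Aub; move/nosup.
Qed.

Lemma riesz_oppr_le x y : - x <= y -> - y <= x.
Proof. by move=> /riesz_leN; rewrite opprK. Qed.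

Lemma riesz_le_oppr x y : x <= - y -> y <= - x.
Proof. by move=> /riesz_leN; rewrite opprK. Qed.

Lemma infimumN A : A !=set0 -> has_lbound A ->
  infimums A (infimum 0 A) /\ infimum 0 A = - supremum 0 (-%R @` A).
Proof.
move=> A0 [m Am].
have [|ub least] := @supremum_is_lub (-%R @` A) (image_nonempty _ A0).
  by exists (- m) => _ [x Ax <-]; apply: riesz_leN; exact: Am.
have inf_sup : infimums A (- supremum 0 (-%R @` A)).
  split=> [x Ax|z Az]; first by apply: riesz_oppr_le; apply: ub; exists x.
  by apply: riesz_le_oppr; apply: least => _ [x Ax <-]; apply: riesz_leN; exact: Az.
suff inf_inf : infimums A (infimum 0 A).
  by split=> //; exact: is_subset1_infimums inf_inf inf_sup.
rewrite /infimum ifF; last by apply/negbTE/set0P.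
by case: xgetP => [x -> //|/(_ _ inf_sup)].
Qed.

End Suprema.

Section Gauges.
Variables (R : realType) (E : rieszType R) (a b : R).
Hypothesis E_complete : dedekind_complete E.
Hypothesis ab : a < b.
Implicit Types W V : R -> R -> E.

(** Interval functions whose sums decrease under refinement and stay bounded below.
    They can be added and scaled, whereas sup_on is not additive in the function;
    working with them turns the statements about upper integrals into linear
    ones. *)
Definition gauge W := superadditive a b W /\
  has_lbound [set itv_sum W a s | s in itv_partition a b].

Definition gauge_inf W : E := infimum 0 [set itv_sum W a s | s in itv_partition a b].

Lemma gauge_infP W : gauge W ->
  infimums [set itv_sum W a s | s in itv_partition a b] (gauge_inf W).
Proof.
move=> [_ Wlb]; have [|//] := infimumN E_complete _ Wlb.
by exists (itv_sum W a [:: b]), [:: b]; first exact: itv_partition1.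
Qed.

Lemma gauge_inf_le W s : gauge W -> itv_partition a b s ->
  gauge_inf W <= itv_sum W a s.
Proof. by move=> /gauge_infP[lb _] abs; apply: lb; exists s. Qed.

Lemma gauge_inf_ge W x : gauge W ->
  (forall s, itv_partition a b s -> x <= itv_sum W a s) -> x <= gauge_inf W.
Proof. by move=> /gauge_infP[_ gl] xW; apply: gl => _ [s abs <-]; exact: xW. Qed.

Lemma gaugeD W V : gauge W -> gauge V -> gauge (fun c d => W c d + V c d).
Proof.
move=> [Wsup [m Wm]] [Vsup [n Vn]]; split.
  move=> c d e ac cd de eb; rewrite addrACA.
  by apply: riesz_leD; [exact: Wsup|exact: Vsup].
exists (m + n) => _ [s abs <-]; rewrite itv_sumD.
by apply: riesz_leD; [apply: Wm|apply: Vn]; exists s.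
Qed.

Lemma gaugeZ (k : R) W : 0 <= k -> gauge W -> gauge (fun c d => k *: W c d).
Proof.
move=> k0 [Wsup [m Wm]]; split.
  move=> c d e ac cd de eb; rewrite -scalerDr.
  by apply: riesz_leZ => //; exact: Wsup.
exists (k *: m) => _ [s abs <-]; rewrite itv_sumZ.
by apply: riesz_leZ => //; apply: Wm; exists s.
Qed.

Lemma gauge_inf_mono W V : gauge W -> gauge V -> le_itv a b W V ->
  gauge_inf W <= gauge_inf V.
Proof.
move=> gW gV WV; apply: gauge_inf_ge => // s abs.
exact: le_trans (gauge_inf_le gW abs) (itv_sum_le WV abs).
Qed.

(** Additivity comes from common refinements: the infimum over one partition for
    both W and V equals the infimum over two independent partitions. *)
Lemma gauge_infD W V : gauge W -> gauge V ->
  gauge_inf (fun c d => W c d + V c d) = gauge_inf W + gauge_inf V.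
Proof.
move=> gW gV; have gWV := gaugeD gW gV; apply/eqP; rewrite eq_le; apply/andP; split.
  rewrite -riesz_lerBlDr; apply: gauge_inf_ge => // s abs.
  rewrite riesz_lerBlDr addrC -riesz_lerBlDr; apply: gauge_inf_ge => // t abt.
  rewrite riesz_lerBlDr addrC; have [r abr rst] := common_refinement E abs abt.
  apply: le_trans (gauge_inf_le gWV abr) _; rewrite itv_sumD.
  by apply: riesz_leD; [case: (rst W gW.1)|case: (rst V gV.1)].
apply: gauge_inf_ge => // s abs; rewrite itv_sumD.
by apply: riesz_leD; exact: gauge_inf_le.
Qed.

Lemma gauge_infZ (k : R) W : 0 <= k -> gauge W ->
  gauge_inf (fun c d => k *: W c d) <= k *: gauge_inf W.
Proof.
move=> k0 gW; have gkW := gaugeZ k0 gW; move: k0; rewrite le_eqVlt => /predU1P[k0|k0].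
  apply: le_trans (gauge_inf_le gkW (itv_partition1 ab)) _.
  by rewrite itv_sumZ -k0 !scale0r.
have kV0 : 0 < k^-1 by rewrite invr_gt0.
have : k^-1 *: gauge_inf (fun c d => k *: W c d) <= gauge_inf W.
  apply: gauge_inf_ge => // s abs.
  have := riesz_leZ _ _ _ (ltW kV0) (gauge_inf_le gkW abs).
  by rewrite itv_sumZ scalerA mulVf ?gt_eqF// scale1r.
by move=> /(riesz_leZ _ _ _ (ltW k0)); rewrite scalerA divff ?gt_eqF// scale1r.
Qed.

End Gauges.

Section UpperIntegrals.
Variables (R : realType) (E : rieszType R) (a b : R).
Hypothesis E_complete : dedekind_complete E.
Hypothesis ab : a < b.
Implicit Types (f g h : R -> E) (c d : R).

Definition sup_on f c d : E := supremum 0 (f @` `[c, d]).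

Lemma order_boundedN f : order_bounded a b f -> order_bounded a b (fun x => - f x).
Proof. by move=> [M M0 fM]; exists M => // x /fM; rewrite riesz_absN. Qed.

Lemma sup_onP f c d : order_bounded a b f -> a <= c -> c < d -> d <= b ->
  supremums (f @` `[c, d]) (sup_on f c d).
Proof.
move=> [M M0 fM] ac cd db; apply: supremum_is_lub => //.
  by exists (f c), c => //=; rewrite in_itv/= lexx ltW.
exists M => _ [x /= + <-]; rewrite in_itv/= => /andP[cx xd].
have /fM/riesz_abs_leP[] // : x \in `[a, b].
by rewrite in_itv/= (le_trans ac cx) (le_trans xd db).
Qed.

Lemma sup_on_ge f c d x : order_bounded a b f -> a <= c -> c < d -> d <= b ->
  c <= x -> x <= d -> f x <= sup_on f c d.
Proof.
move=> fb ac cd db cx xd; have [ub _] := sup_onP fb ac cd db.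
by apply: ub; exists x => //=; rewrite in_itv/= cx.
Qed.

Lemma sup_on_le f c d z : order_bounded a b f -> a <= c -> c < d -> d <= b ->
  (forall x, c <= x -> x <= d -> f x <= z) -> sup_on f c d <= z.
Proof.
move=> fb ac cd db fz; have [_ least] := sup_onP fb ac cd db.
by apply: least => _ [x /= + <-]; rewrite in_itv/= => /andP[]; exact: fz.
Qed.

Definition sup_gauge f c d := (d - c) *: sup_on f c d.

Lemma sup_gaugeP f : order_bounded a b f -> gauge a b (sup_gauge f).
Proof.
move=> fb; split=> [c d e ac cd de eb|].
  have ce := lt_trans cd de; have db := ltW (lt_le_trans de eb).
  have ad := ltW (le_lt_trans ac cd).
  apply: (@le_trans _ _ ((d - c) *: sup_on f c e + (e - d) *: sup_on f c e)).
    apply: riesz_leD; apply: riesz_leZ; do ?[by rewrite subr_ge0 ltW].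
      apply: sup_on_le => // x cx xd; apply: sup_on_ge => //.
      exact: le_trans xd (ltW de).
    apply: sup_on_le => // x dx xe; apply: sup_on_ge => //.
    exact: le_trans (ltW cd) dx.
  by rewrite -scalerDl /sup_gauge; have -> : d - c + (e - d) = e - c by ring.
have [M M0 fM] := fb; exists ((b - a) *: (- M)) => _ [s abs <-].
rewrite -(itv_sum_length (- M) abs); apply: itv_sum_le abs => c d ac cd db.
apply: riesz_leZ; first by rewrite subr_ge0 ltW.
apply: le_trans (sup_on_ge fb ac cd db (lexx c) (ltW cd)).
have /fM/riesz_abs_leP[_ fcM] : c \in `[a, b].
  by rewrite in_itv/= ac (ltW (lt_le_trans cd db)).
exact: riesz_oppr_le.
Qed.

Lemma upper_integralE f : upper_integral a b f = gauge_inf a b (sup_gauge f).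
Proof.
rewrite /upper_integral /gauge_inf; congr (infimum _ (_ @` _)).
by apply/funext => s; rewrite -(itv_sum_nth _ _ b).
Qed.

(** Because of this identity it is enough to study upper integrals. *)
Lemma lower_integralE f : order_bounded a b f ->
  lower_integral a b f = - upper_integral a b (fun x => - f x).
Proof.
move=> fb; have Nfb := order_boundedN fb.
have sumE s : itv_partition a b s ->
    lower_sum a b f s = - upper_sum a b (fun x => - f x) s.
  move=> abs; rewrite /lower_sum /upper_sum.
  rewrite (itv_sum_nth (fun c d => (d - c) *: infimum 0 (f @` `[c, d])) a b s).
  rewrite (itv_sum_nth (sup_gauge (fun x => - f x)) a b s) -scaleN1r -itv_sumZ.
  have infE c d : a <= c -> c < d -> d <= b ->
      (d - c) *: infimum 0 (f @` `[c, d]) = -1 *: sup_gauge (fun x => - f x) c d.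
    move=> ac cd db; have [ub least] := sup_onP Nfb ac cd db.
    rewrite /sup_gauge scalerA mulN1r scaleNr -scalerN.
    have [||_ ->] := @infimumN _ _ E_complete (f @` `[c, d]).
    - by exists (f c), c => //=; rewrite in_itv/= lexx ltW.
    - exists (- sup_on (fun x => - f x) c d) => _ [x xcd <-].
      by apply: riesz_oppr_le; apply: ub; exists x.
    by rewrite image_comp.
  by apply/eqP; rewrite eq_le; apply/andP; split; apply: itv_sum_le abs => c d ac cd db;
    rewrite infE.
have gN := sup_gaugeP Nfb; have [lb great] := gauge_infP E_complete ab gN.
rewrite upper_integralE /lower_integral.
have sup_lower : supremums [set lower_sum a b f s | s in itv_partition a b]
    (- gauge_inf a b (sup_gauge (fun x => - f x))).
  have upE s : upper_sum a b (fun x => - f x) s =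
    itv_sum (sup_gauge (fun x => - f x)) a s by rewrite -(itv_sum_nth _ _ b).
  split=> [_ [s abs <-]|z zub].
    by rewrite sumE// upE; apply: riesz_leN; apply: lb; exists s.
  apply: riesz_oppr_le; apply: great => _ [s abs <-]; apply: riesz_oppr_le.
  by rewrite -upE -sumE//; apply: zub; exists s.
apply: (is_subset1_supremums _ sup_lower); apply: supremum_is_lub => //.
  by exists (lower_sum a b f [:: b]), [:: b]; first exact: itv_partition1.
by case: sup_lower => ub _; eexists; exact: ub.
Qed.

Lemma upper_integral_lincomb h f g (k l : R) :
  order_bounded a b h -> order_bounded a b f -> order_bounded a b g ->
  0 <= k -> 0 <= l ->
  (forall x, a <= x -> x <= b -> h x <= k *: f x + l *: g x) ->
  upper_integral a b h <= k *: upper_integral a b f + l *: upper_integral a b g.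
Proof.
move=> hb fb gb k0 l0 hfg; rewrite !upper_integralE.
have gf := sup_gaugeP fb; have gg := sup_gaugeP gb.
have gkf := gaugeZ k0 gf; have glg := gaugeZ l0 gg.
apply: (@le_trans _ _ (gauge_inf a b
    (fun c d => k *: sup_gauge f c d + l *: sup_gauge g c d))).
  apply: gauge_inf_mono => //; [exact: sup_gaugeP|exact: gaugeD|].
  move=> c d ac cd db; rewrite /sup_gauge scalerA scalerA.
  rewrite ![_ * (d - c)]mulrC -!scalerA -scalerDr.
  apply: riesz_leZ; first by rewrite subr_ge0 ltW.
  apply: sup_on_le => // x cx xd.
  apply: le_trans (hfg x (le_trans ac cx) (le_trans xd db)) _.
  by apply: riesz_leD; apply: riesz_leZ => //; exact: sup_on_ge.
by rewrite gauge_infD//; apply: riesz_leD; exact: gauge_infZ.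
Qed.

Lemma upper_integral_ge0 f : order_bounded a b f ->
  (forall x, a <= x -> x <= b -> 0 <= f x) -> 0 <= upper_integral a b f.
Proof.
move=> fb f0; rewrite upper_integralE.
apply: gauge_inf_ge => //; first exact: sup_gaugeP.
move=> s abs; rewrite -(scaler0 _ (b - a)) -(itv_sum_length 0 abs).
apply: itv_sum_le abs => c d ac cd db.
apply: riesz_leZ; first by rewrite subr_ge0 ltW.
apply: le_trans (sup_on_ge fb ac cd db (lexx c) (ltW cd)).
exact: f0 (ltW (lt_le_trans cd db)).
Qed.

Lemma riemann_integrableP f : riemann_integrable a b f <->
  order_bounded a b f /\
  upper_integral a b f + upper_integral a b (fun x => - f x) = 0.
Proof.
split=> -[fb fE]; split=> //.
  by rewrite -fE lower_integralE// addNr.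
by rewrite lower_integralE//; apply/eqP; rewrite eq_sym -addr_eq0 fE.
Qed.

Lemma riemann_integralN f : riemann_integrable a b f ->
  upper_integral a b (fun x => - f x) = - riemann_integral a b f.
Proof. by move=> /riemann_integrableP[_ /eqP]; rewrite addrC addr_eq0 => /eqP. Qed.

(** On each interval, sup h + sup (- h) is the oscillation of h; it is at most k
    times the sum of the oscillations of f and g.  By additivity of gauge_inf,
    the upper integrals of h and - h then have a sum between 0 and
    k (0 + 0) = 0. *)
Lemma riemann_integrable_oscillation f g h (k : R) :
  riemann_integrable a b f -> riemann_integrable a b g -> 0 <= k ->
  (forall x y, x \in `[a, b] -> y \in `[a, b] ->
    riesz_abs (h x - h y) <=
      k *: (riesz_abs (f x - f y) + riesz_abs (g x - g y))) ->
  riemann_integrable a b h.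
Proof.
move=> /riemann_integrableP[fb fE] /riemann_integrableP[gb gE] k0 hfg.
have aab : a \in `[a, b] by rewrite in_itv/= lexx ltW.
have dist_bound f' M x y : (forall x, x \in `[a, b] -> riesz_abs (f' x) <= M) ->
    x \in `[a, b] -> y \in `[a, b] -> riesz_abs (f' x - f' y) <= M + M.
  move=> fM /fM/riesz_abs_leP[xM NxM] /fM/riesz_abs_leP[yM NyM].
  by apply/riesz_abs_leP; split; rewrite ?opprB 1?addrC; exact: riesz_leD.
have hb : order_bounded a b h.
  have [M M0 fM] := fb; have [N N0 gN] := gb.
  exists (k *: ((M + M) + (N + N)) + riesz_abs (h a)) => [|x xab].
    apply: (@le_trans _ _ (k *: 0 + 0)); first by rewrite scaler0 addr0.
    apply: riesz_leD (riesz_abs_ge0 _); apply: riesz_leZ => //.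
    by rewrite -[0](addr0) -[0 in X in X <= _](addr0); do !apply: riesz_leD.
  have /riesz_abs_leP[h1 h2] := hfg _ _ xab aab.
  have /riesz_abs_leP[h3 h4] := lexx (riesz_abs (h a)).
  have le : k *: (riesz_abs (f x - f a) + riesz_abs (g x - g a)) <=
      k *: ((M + M) + (N + N)).
    by apply: riesz_leZ => //; apply: riesz_leD; exact: dist_bound.
  apply/riesz_abs_leP; split.
    by rewrite -[h x](subrK (h a)); apply: riesz_leD => //; exact: le_trans le.
  rewrite -[h x](subrK (h a)) opprD; apply: riesz_leD => //; exact: le_trans le.
have osc f' c d x y : order_bounded a b f' -> a <= c -> c < d -> d <= b ->
    c <= x -> x <= d -> c <= y -> y <= d ->
    riesz_abs (f' x - f' y) <= sup_on f' c d + sup_on (fun z => - f' z) c d.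
  move=> fb' ac cd db cx xd cy yd; have Nfb' := order_boundedN fb'.
  apply/riesz_abs_leP; split; rewrite ?opprB; apply: riesz_leD;
    do ?[exact: sup_on_ge | exact: (@sup_on_ge (fun z => - f' z))].
have Nfb := order_boundedN fb; have Ngb := order_boundedN gb.
have Nhb := order_boundedN hb.
apply/riemann_integrableP; split=> //; rewrite !upper_integralE in fE gE *.
have gf := sup_gaugeP fb; have gNf := sup_gaugeP Nfb.
have gg := sup_gaugeP gb; have gNg := sup_gaugeP Ngb.
have gh := sup_gaugeP hb; have gNh := sup_gaugeP Nhb.
have gff := gaugeD gf gNf; have ggg := gaugeD gg gNg.
rewrite -(gauge_infD E_complete ab gh gNh).
rewrite -gauge_infD// in fE; rewrite -gauge_infD// in gE.
have gfg := gaugeD gff ggg.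
apply/eqP; rewrite eq_le; apply/andP; split.
  have <- : k *: gauge_inf a b (fun c d =>
      sup_gauge f c d + sup_gauge (fun x => - f x) c d +
      (sup_gauge g c d + sup_gauge (fun x => - g x) c d)) = 0.
    by rewrite gauge_infD// fE gE addr0 scaler0.
  apply: le_trans (gauge_infZ E_complete ab k0 gfg).
  apply: gauge_inf_mono => //; [exact: gaugeD|exact: gaugeZ|].
  move=> c d ac cd db; rewrite /sup_gauge -!scalerDr scalerA mulrC -scalerA.
  apply: riesz_leZ; first by rewrite subr_ge0 ltW.
  set D := k *: _.
  have inD x : c <= x -> x <= d -> x \in `[a, b].
    by move=> cx xd; rewrite in_itv/= (le_trans ac cx) (le_trans xd db).
  have hD x y : c <= x -> x <= d -> c <= y -> y <= d -> h x - h y <= D.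
    move=> cx xd cy yd.
    have [hxy _] := (riesz_abs_leP _ _).1 (hfg x y (inD _ cx xd) (inD _ cy yd)).
    by apply: le_trans hxy _; apply: riesz_leZ => //; apply: riesz_leD; exact: osc.
  rewrite -[sup_on (fun x => - h x) c d]opprK riesz_lerBlDr.
  apply: sup_on_le => // x cx xd; rewrite -riesz_lerBlDr opprK addrC.
  rewrite -[h x]opprK riesz_lerBlDr.
  apply: (@sup_on_le (fun x => - h x)) => // y cy yd.
  by rewrite -riesz_lerBlDr opprK addrC; exact: hD.
apply: gauge_inf_ge => //; first exact: gaugeD.
move=> s abs; rewrite -(scaler0 _ (b - a)) -(itv_sum_length 0 abs).
apply: itv_sum_le abs => c d ac cd db.
rewrite /sup_gauge -scalerDr; apply: riesz_leZ; first by rewrite subr_ge0 ltW.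
rewrite -(subrr (h c)).
by apply: riesz_leD; [exact: (sup_on_ge hb ac cd db (lexx c) (ltW cd))|
  exact: (sup_on_ge Nhb ac cd db (lexx c) (ltW cd))].
Qed.

End UpperIntegrals.

(** * Hoelder's inequality with respect to an order unit *)

Section RieszHoelder.
Variables (R : realType) (F : rieszType R) (u : F) (mul : F -> F -> F) (a b : R).
Hypotheses (F_complete : dedekind_complete F) (u_ge0 : 0 <= u) (uP : order_unit u).
Hypotheses (mulP : f_algebra_mul mul u) (ab : a < b).
Implicit Types (f g : R -> F).

Let ev : F -> spectrum u -> R := @spectrum_eval R F u.

Let repr : CK_representation u ev.
Proof. exact: spectrum_representation. Qed.

Let evC k : is_character u (ev ^~ k).
Proof. exact: CK_character repr k. Qed.

Let ev_abs x k : ev (riesz_abs x) k = `|ev x k|.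
Proof. exact: (character_abs (evC k)). Qed.

Let evD x y k : ev (x + y) k = ev x k + ev y k.
Proof. exact: (characterD (evC k)). Qed.

Let evN x k : ev (- x) k = - ev x k.
Proof. exact: (characterN (evC k)). Qed.

Let evZ c x k : ev (c *: x) k = c * ev x k.
Proof. exact: (characterZ (evC k)). Qed.

Let ev_mul x y k : ev (mul x y) k = ev x k * ev y k.
Proof. exact: (f_algebra_character mulP (evC k) uP). Qed.

Let ev_pow_abs r x k : 0 < r -> ev (riesz_power u r (riesz_abs x)) k = `|ev x k| `^ r.
Proof.
by move=> r0; rewrite (riesz_powerE k repr r0 (riesz_abs_ge0 x)) ev_abs.
Qed.

Let ev_bound f : order_bounded a b f ->
  exists2 m : R, 0 <= m & forall x k, x \in `[a, b] -> `|ev (f x) k| <= m.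
Proof.
move=> [M M0 fM]; have [m m0 Mm] := uP M; exists m => // x k xab.
apply: (character_bound (evC k)); apply: le_trans (fM x xab) _.
exact: ((riesz_abs_leP _ _).1 Mm).1.
Qed.

Lemma riemann_integrable_power_abs f r : 1 < r -> riemann_integrable a b f ->
  riemann_integrable a b (fun x => riesz_power u r (riesz_abs (f x))).
Proof.
move=> r1 fRI; have r0 : 0 < r by lra.
have [m m0 fm] := ev_bound fRI.1.
have k0 : 0 <= r * m `^ (r - 1) by rewrite mulr_ge0 ?powR_ge0 ?ltW.
apply: (riemann_integrable_oscillation F_complete ab fRI fRI k0) => x y xab yab.
apply/(CK_leP repr) => k.
rewrite evZ evD !ev_abs !evD !evN !ev_pow_abs//.
apply: (@le_trans _ _ (r * m `^ (r - 1) * `| `|ev (f x) k| - `|ev (f y) k| |)).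
  by apply: powR_lipschitz; rewrite ?normr_ge0 ?fm.
rewrite ler_wpM2l//; apply: le_trans (ler_dist_dist _ _) _.
by rewrite lerDl.
Qed.

(** Pointwise, s t - s' t' = (s - s') t + s' (t - t'). *)
Lemma riemann_integrable_mul f g :
  riemann_integrable a b f -> riemann_integrable a b g ->
  riemann_integrable a b (fun x => mul (f x) (g x)).
Proof.
move=> fRI gRI; have [m m0 fm] := ev_bound fRI.1; have [n n0 gn] := ev_bound gRI.1.
have k0 : 0 <= m + n by exact: addr_ge0.
apply: (riemann_integrable_oscillation F_complete ab fRI gRI k0) => x y xab yab.
apply/(CK_leP repr) => k; rewrite evZ evD !ev_abs !evD !evN !ev_mul.
set s := ev (f x) k; set s' := ev (f y) k; set t := ev (g x) k; set t' := ev (g y) k.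
have -> : s * t - s' * t' = (s - s') * t + s' * (t - t') by ring.
apply: le_trans (ler_normD _ _) _; rewrite !normrM.
have h1 : `|s - s'| * `|t| <= `|s - s'| * n by rewrite ler_wpM2l ?gn.
have h2 : `|s'| * `|t - t'| <= m * `|t - t'| by rewrite ler_wpM2r ?fm.
have h3 : 0 <= m * `|s - s'| by rewrite mulr_ge0.
have h4 : 0 <= n * `|t - t'| by rewrite mulr_ge0.
by lra.
Qed.

Lemma optimal_young_mul p q (A B z : F) : 0 < p -> 0 < q -> p^-1 + q^-1 = 1 ->
  0 <= A -> 0 <= B ->
  (forall x y, 0 < x -> 0 < y ->
    z <= young_coef1 p x y *: A + young_coef2 q x y *: B) ->
  z <= mul (riesz_power u p^-1 A) (riesz_power u q^-1 B).
Proof.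
move=> p0 q0 pq A0 B0 zAB; apply/(CK_leP repr) => k.
have pV0 : 0 < p^-1 by rewrite invr_gt0.
have qV0 : 0 < q^-1 by rewrite invr_gt0.
rewrite [leRHS]ev_mul (riesz_powerE k repr pV0 A0) (riesz_powerE k repr qV0 B0).
apply: (optimal_young p0 q0 pq ((CK_ge0P repr A).1 A0 k) ((CK_ge0P repr B).1 B0 k)).
move=> x y x0 y0; rewrite -!evZ -evD.
exact: (CK_leP repr _ _).1 (zAB x y x0 y0) k.
Qed.

Theorem riesz_hoelder f g p q : 1 < p -> 1 < q -> p^-1 + q^-1 = 1 ->
  riemann_integrable a b f -> riemann_integrable a b g ->
  riesz_abs (riemann_integral a b (fun x => mul (f x) (g x))) <=
  mul (riesz_power u p^-1
        (riemann_integral a b (fun x => riesz_power u p (riesz_abs (f x)))))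
      (riesz_power u q^-1
        (riemann_integral a b (fun x => riesz_power u q (riesz_abs (g x))))).
Proof.
move=> p1 q1 pq fRI gRI.
have p0 : 0 < p by lra.
have q0 : 0 < q by lra.
have fgRI := riemann_integrable_mul fRI gRI.
have fpRI := riemann_integrable_power_abs p1 fRI.
have gqRI := riemann_integrable_power_abs q1 gRI.
set fg := fun x => mul (f x) (g x) in fgRI *.
set fp := fun x => riesz_power u p (riesz_abs (f x)) in fpRI *.
set gq := fun x => riesz_power u q (riesz_abs (g x)) in gqRI *.
have int_ge0 (h : R -> F) r : 0 < r ->
    riemann_integrable a b (fun x => riesz_power u r (riesz_abs (h x))) ->
    0 <= riemann_integral a b (fun x => riesz_power u r (riesz_abs (h x))).
  move=> r0 hRI; apply: upper_integral_ge0 => //; first exact: hRI.1.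
  by move=> x _ _; apply/(CK_ge0P repr) => k; rewrite ev_pow_abs// powR_ge0.
have A0 := int_ge0 f p p0 fpRI; have B0 := int_ge0 g q q0 gqRI.
apply: (optimal_young_mul p0 q0 pq A0 B0) => x y x0 y0.
have c10 : 0 <= young_coef1 p x y.
  by rewrite /young_coef1 !divr_ge0 ?mulr_ge0 ?powR_ge0 ?ltW.
have c20 : 0 <= young_coef2 q x y.
  by rewrite /young_coef2 !divr_ge0 ?mulr_ge0 ?powR_ge0 ?ltW.
have young z k' : `|ev (fg z) k'| <=
    ev (young_coef1 p x y *: fp z + young_coef2 q x y *: gq z) k'.
  rewrite evD !evZ !ev_pow_abs// ev_mul normrM.
  exact: scaled_young.
apply/riesz_abs_leP; split; last rewrite -riemann_integralN//.
  apply: upper_integral_lincomb => //; [exact: fgRI.1|exact: fpRI.1|exact: gqRI.1|].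
  move=> z _ _; apply/(CK_leP repr) => k'.
  exact: le_trans (ler_norm _) (young z k').
apply: upper_integral_lincomb => //;
  [exact: order_boundedN fgRI.1|exact: fpRI.1|exact: gqRI.1|].
move=> z _ _; apply/(CK_leP repr) => k'; rewrite evN.
by apply: le_trans (young z k'); rewrite -normrN ler_norm.
Qed.

End RieszHoelder.

(** * The order ideal generated by a positive element *)

Section OrderIdealProperties.
Variables (R : realType) (E : rieszType R) (e : E).
Hypotheses (E_complete : dedekind_complete E) (e_gt0 : 0 < e).

(** The supremum in E of a set that is order bounded in the ideal lies between two
    elements of the ideal. *)
Lemma order_ideal_dedekind_complete : dedekind_complete (order_ideal e).
Proof.
move=> A [x0 Ax0] [M AM].
have [||s [ub least]] := E_complete (A := (@ideal_val _ _ e) @` A).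
- by exists (ideal_val x0), x0.
- by exists (ideal_val M) => _ [x Ax <-]; have := AM x Ax; rewrite -Order.le_val.
have sI : s \in order_ideal_pred e.
  apply: (order_ideal_convex (valP x0) (valP M)) => t.
    move=> _; apply: le_trans; apply: least => _ [x Ax <-].
    by have := AM x Ax; rewrite -Order.le_val.
  by move=> tx0 _; apply: le_trans tx0 _; apply: ub; exists x0.
exists (OrderIdeal sI); split=> [x Ax|z zub]; rewrite -Order.le_val.
  by apply: ub; exists x.
by apply: least => _ [x Ax <-]; have := zub x Ax; rewrite -Order.le_val.
Qed.

Lemma ideal_unit_order_unit : order_unit (ideal_unit e_gt0).
Proof.
move=> x; have /order_idealP[m m0 xm] := valP x.
by exists m => //; rewrite -Order.le_val.
Qed.

Lemma ideal_unit_ge0 : 0 <= ideal_unit e_gt0.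
Proof. by rewrite -Order.le_val; exact: ltW. Qed.

End OrderIdealProperties.

Theorem theorem3p6 (R : realType) (E : rieszType R)
  (E_complete : dedekind_complete E)
  (e : E) (e_gt0 : 0 < e) (e_unit : weak_order_unit e)
  (mul : order_ideal e -> order_ideal e -> order_ideal e)
  (mulP : f_algebra_mul mul (ideal_unit e_gt0))
  (a b : R) (ab : a < b)
  (f g : R -> order_ideal e)
  (f_RI : riemann_integrable a b f) (g_RI : riemann_integrable a b g)
  (p q : R) (p_ge1 : 1 <= p) (q_ge1 : 1 <= q) (pq : p^-1 + q^-1 = 1) :
  let pow := riesz_power (ideal_unit e_gt0) in
  let fg := fun x => mul (f x) (g x) in
  let fp := fun x => pow p (riesz_abs (f x)) in
  let gq := fun x => pow q (riesz_abs (g x)) in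
  [/\ riemann_integrable a b fg,
      riemann_integrable a b fp,
      riemann_integrable a b gq
    & riesz_abs (riemann_integral a b fg) <=
      mul (pow p^-1 (riemann_integral a b fp))
          (pow q^-1 (riemann_integral a b gq))].
Proof.
have I_complete := order_ideal_dedekind_complete E_complete (e := e).
have u_ge0 := ideal_unit_ge0 e_gt0; have uP := ideal_unit_order_unit e_gt0.
(* If p were 1, then q^-1 would be 0, which q >= 1 excludes. *)
have gt1 (r s : R) : 1 <= r -> 1 <= s -> r^-1 + s^-1 = 1 -> 1 < r.
  move=> r1 s1 rs; rewrite -invf_lt1; last by lra.
  have : 0 < s^-1 by rewrite invr_gt0; lra.
  by lra.
have p1 := gt1 p q p_ge1 q_ge1 pq.
have q1 : 1 < q by apply: gt1 q_ge1 p_ge1 _; rewrite addrC.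
split.
- exact: (riemann_integrable_mul I_complete u_ge0 uP mulP ab).
- exact: (riemann_integrable_power_abs I_complete u_ge0 uP ab).
- exact: (riemann_integrable_power_abs I_complete u_ge0 uP ab).
- exact: (riesz_hoelder I_complete u_ge0 uP mulP ab).
Qed.
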